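(* Let $S$ be any set, $F_S$ the free group on $S$, and $F_S^{\mathbb{Q}}$ the free $\mathbb{Q}$-group on $S$. Then the canonical embedding $F_S \to F_S^{\mathbb{Q}}$ is isometric for $\operatorname{scl}$.
   Context: A $\mathbb{Q}$-group is a group together with a map $G\times\mathbb{Q}\to G$, $(g,a)\mapsto g^a$, such that for all $g,h\in G$, $a,b\in\mathbb{Q}$: $g^0=e$, $g^1=g$, $e^a=e$; $g^{a+b}=g^ag^b$, $(g^a)^b=g^{ab}$; $(hgh^{-1})^a=hg^ah^{-1}$; and if $gh=hg$ then $(gh)^a=g^ah^a$. (Equivalently, every element has a unique $k$-th root for each $k\ge1$.) The free $\mathbb{Q}$-group $F_S^{\mathbb{Q}}$ is the $\mathbb{Q}$-completion of $F_S$: a $\mathbb{Q}$-group with a homomorphism $F_S\to F_S^{\mathbb{Q}}$ through which every homomorphism from $F_S$ to a $\mathbb{Q}$-group factors uniquely via a homomorphism commuting with the $\mathbb{Q}$-powers. Stable commutator length on chains: for a group $G$, $\operatorname{C}_1(G)$ is the real vector space with basis $G$. For an integral chain $c=\sum_i g_i$ ($g_i\in G$, repetitions allowed), $\operatorname{cl}_G(c)$ is the minimal number of commutators whose product equals some $\prod_i t_ig_it_i^{-1}$ with $t_i\in G$ (infinite if none), and $\operatorname{scl}_G(c)=\lim_{n\to\infty}\operatorname{cl}_G(\sum_i g_i^n)/n$; this extends by homogeneity to rational chains and by continuity to real chains, taking the value $\infty$ off the boundaries. $\operatorname{C}_1^H(G)$ is the quotient of $\operatorname{C}_1(G)$ by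 the span of all $g^n-ng$ ($g\in G,n\in\mathbb{Z}$) and $hgh^{-1}-g$ ($g,h\in G$); $\operatorname{scl}_G$ descends to $\operatorname{C}_1^H(G)$. A homomorphism $G_1\to G_2$ is isometric for $\operatorname{scl}$ if the induced map $\operatorname{C}_1^H(G_1)\to\operatorname{C}_1^H(G_2)$ satisfies $\operatorname{scl}_{G_2}(f(c))=\operatorname{scl}_{G_1}(c)$ for all $c$ (including chains with infinite $\operatorname{scl}$). *)

(* Defs.v *)
From HB Require Import structures.
From mathcomp Require Import all_boot all_order all_algebra.
From mathcomp Require Import all_classical all_reals.
From mathcomp Require Import constructive_ereal ereal sequences.
Set Implicit Arguments. Unset Strict Implicit. Unset Printing Implicit Defensive.
Import Order.TTheory GRing.Theory Num.Theory.
Local Open Scope ring_scope.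

Record Grp := MkGroup {
  gcar :> Type;
  gmul : gcar -> gcar -> gcar;
  gone : gcar;
  ginv : gcar -> gcar;
  gmulA : forall x y z, gmul x (gmul y z) = gmul (gmul x y) z;
  gmul1l : forall x, gmul gone x = x;
  gmul1r : forall x, gmul x gone = x;
  gmulVl : forall x, gmul (ginv x) x = gone;
  gmulVr : forall x, gmul x (ginv x) = gone }.

Definition is_hom (G H : Grp) (f : G -> H) : Prop :=
  forall x y, f (gmul x y) = gmul (f x) (f y).

Definition is_free_group (S : Type) (F : Grp) (iS : S -> F) : Prop :=
  forall (H : Grp) (phi : S -> H),
    exists psi : F -> H, is_hom psi /\ (forall s, psi (iS s) = phi s) /\
      forall psi' : F -> H, is_hom psi' -> (forall s, psi' (iS s) = phi s) ->
        forall x, psi' x = psi x.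

Record QGrp := MkQGroup {
  qgrp :> Grp;
  qpow : qgrp -> rat -> qgrp;
  qpow0 : forall g, qpow g 0 = gone qgrp;
  qpow1 : forall g, qpow g 1 = g;
  qpow_one : forall a, qpow (gone qgrp) a = gone qgrp;
  qpowD : forall g a b, qpow g (a + b) = gmul (qpow g a) (qpow g b);
  qpowM : forall g a b, qpow (qpow g a) b = qpow g (a * b);
  qpowJ : forall g h a,
    qpow (gmul h (gmul g (ginv h))) a = gmul h (gmul (qpow g a) (ginv h));
  qpowMcomm : forall g h a, gmul g h = gmul h g ->
    qpow (gmul g h) a = gmul (qpow g a) (qpow h a) }.

Definition is_Qhom (G H : QGrp) (f : G -> H) : Prop :=
  is_hom f /\ forall g a, f (qpow g a) = qpow (f g) a.

(** Q-completion (free Q-group on S when F is the free group on S):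
    j : F -> FQ is a homomorphism through which every homomorphism from F
    to a Q-group factors uniquely via a Q-homomorphism. *)
Definition is_Q_completion (F : Grp) (FQ : QGrp) (j : F -> FQ) : Prop :=
  is_hom j /\
  forall (G : QGrp) (phi : F -> G), is_hom phi ->
    exists psi : FQ -> G, is_Qhom psi /\ (forall x, psi (j x) = phi x) /\
      forall psi' : FQ -> G, is_Qhom psi' -> (forall x, psi' (j x) = phi x) ->
        forall y, psi' y = psi y.

Section SCL.
Variable G : Grp.

Definition gprod (s : seq G) : G := foldr (@gmul G) (gone G) s.
Fixpoint gpow (g : G) (n : nat) : G :=
  match n with O => gone G | S n' => gmul g (gpow g n') end.
Definition gcomm (a b : G) : G := gmul (gmul (ginv a) (ginv b)) (gmul a b).
Definition gconj (t g : G) : G := gmul t (gmul g (ginv t)).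

(** the integral chain g_1 + ... + g_m (list gs) has cl <= k *)
Definition cl_le (gs : seq G) (k : nat) : Prop :=
  exists (ts : seq G) (ps : seq (G * G)),
    size ts = size gs /\ size ps = k /\
    gprod [seq gconj tg.1 tg.2 | tg <- zip ts gs] =
    gprod [seq gcomm p.1 p.2 | p <- ps].

Variable R : realType.
Local Open Scope ereal_scope.

(** cl of an integral chain, +oo if there is no such product *)
Definition cl (gs : seq G) : \bar R :=
  ereal_inf [set (k%:R)%:E | k in [set k : nat | cl_le gs k]].

(** scl of an integral chain: lim cl(sum g_i^n)/n (taken as liminf) *)
Definition scl_int (gs : seq G) : \bar R :=
  limn_einf (fun n : nat => cl [seq gpow g n | g <- gs] * ((n%:R)^-1)%:E).

(** integral chain with signed coefficients: z.g with z < 0 is read as |z|.g^-1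
    (these agree in C_1^H, on which scl is defined) *)
Definition expand_int (c : seq (G * int)) : seq G :=
  flatten [seq (if (0 <= p.2)%R then nseq `|p.2|%N p.1 else nseq `|p.2|%N (ginv p.1))
          | p <- c].

(** rational chains, by homogeneity: scl(c) = scl(N c) / N *)
Definition scl_rat (c : seq (G * rat)) : \bar R :=
  let N : int := (\prod_(p <- c) denq p.2)%R in
  scl_int (expand_int [seq (p.1, numq (p.2 * N%:~R)) | p <- c])
    * ((N%:~R : R)^-1)%:E.

(** real chains, by continuity: liminf of scl over rational chains with the same
    support and coefficients converging to those of c *)
Definition scl (c : seq (G * R)) : \bar R :=
  ereal_sup [set ereal_inf
     [set scl_rat (zip (unzip1 c) qs) | qs in
        [set qs : seq rat | size qs = size c /\
           forall i, (i < size c)%N ->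
             (`| ratr (nth 0%R qs i) - (nth 0%R (unzip2 c) i) | < e)%R]]
   | e in [set e : R | (0 < e)%R]].
End SCL.

Definition push_chain (G H : Grp) (f : G -> H) (R : realType) (c : seq (G * R))
  : seq (H * R) := [seq (f p.1, p.2) | p <- c].

(** f is isometric for scl: scl is preserved on every (real) chain
    (hence on C_1^H, to which scl descends). *)
Definition scl_isometric (G H : Grp) (f : G -> H) : Prop :=
  forall (R : realType) (c : seq (G * R)), scl (push_chain f c) = scl c.

(* Main.v *)
(* A finite-index transfer shows that adjoining roots does not decrease scl. If
   K = G *_C A with A abelian and A/C of prime order p, the inclusion of G and
   the representation induced from C to A combine to a homomorphism from K to
   the wreath product of G with Sym(p) whose restriction to G is diagonal.
   Iterating, every finitely related piece of an iterated root extension of F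
   maps to some F wr Sym(X) with F diagonal. An equation exhibiting cl <= k for
   a diagonal chain of r terms in F wr Sym(X) consists of N = #|X| equations in
   F, whose product is a quadratic word with constants; this gives
   cl (sum g_i^N) <= N (k + 3 r), and the error 3 r disappears after division by
   n when k bounds cl (sum g_i^n).

   It remains to map F^Q to such an iterated extension, for which the limit must
   have unique roots. At each step we adjoin p-th roots simultaneously along
   representatives of all maximal locally cyclic subgroups (isolators), which are
   malnormal and pairwise non-conjugate. Uniqueness of roots, and the property
   that g x^k g^-1 = x^l forces g to be commensurable with x, pass to the
   amalgam: the action on the Bass-Serre tree, encoded by a Lyndon length
   function, is acylindrical, so that elements are either conjugate into an
   abelian vertex group or hyperbolic, and in the latter case they are controlled
   on their axis. *)

(* The universal property of [F^Q] is used for a single map, into one Q-group [Q] built by hand: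
   homomorphisms do not increase cl, so an equation bounding cl in [F^Q] gives one in [Q], hence one
   at a finite stage of the tower. Only lower limits of cl(sum g_i^n)/n are compared, so the degree
   N may depend on n and on the equation: a bound k at exponent n over [Q] gives the bound N (k + 3
   r) at exponent n N over [F]. The invariant carried up the tower is the conjunction of
   [unique_roots] and [cyclic_normalizers]. The second expresses malnormality of isolators without
   asking them to be cyclic. Isolators have rank 1, so C/C^p has order 1 or p for p prime; this
   keeps the induced representations of finite degree at every stage. *)
Require Import Defs.
From mathcomp Require Import all_boot all_order all_algebra all_fingroup.
From mathcomp Require Import all_classical all_reals.
From mathcomp Require Import constructive_ereal ereal sequences.
From mathcomp Require Import zify ring.

Set Implicit Arguments.
Unset Strict Implicit.
Unset Printing Implicit Defensive.
Import Order.TTheory GRing.Theory Num.Theory.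

Declare Scope grp_scope.
Delimit Scope grp_scope with grp.
Bind Scope grp_scope with gcar.
Notation "x * y" := (gmul x y) : grp_scope.
Notation "x ^-1" := (ginv x) : grp_scope.
Notation "1" := (gone _) : grp_scope.
Notation "x ^+ n" := (gpow x n) : grp_scope.
Local Open Scope grp_scope.

(** * Groups *)

Section GroupLaws.
Variable G : Grp.
Implicit Types x y z t : G.

Lemma gmulVK x y : x^-1 * (x * y) = y.
Proof. by rewrite gmulA gmulVl gmul1l. Qed.

Lemma gmulKV x y : x * (x^-1 * y) = y.
Proof. by rewrite gmulA gmulVr gmul1l. Qed.

Lemma gmulK x y : y * x * x^-1 = y.
Proof. by rewrite -gmulA gmulVr gmul1r. Qed.

Lemma gmulVKr x y : y * x^-1 * x = y.
Proof. by rewrite -gmulA gmulVl gmul1r. Qed.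

Lemma gmulI x y z : x * y = x * z -> y = z.
Proof. by move=> e; rewrite -(gmulVK x y) e gmulVK. Qed.

Lemma gmulIr x y z : y * x = z * x -> y = z.
Proof. by move=> e; rewrite -(gmulK x y) e gmulK. Qed.

Lemma ginv_uniq x y : x * y = 1 -> y = x^-1.
Proof. by move=> e; apply: (@gmulI x); rewrite e gmulVr. Qed.

Lemma ginvK x : x^-1^-1 = x.
Proof. by apply/esym/ginv_uniq; rewrite gmulVl. Qed.

Lemma ginv1 : (1 : G)^-1 = 1.
Proof. by apply/esym/ginv_uniq; rewrite gmul1l. Qed.

Lemma ginvM x y : (x * y)^-1 = y^-1 * x^-1.
Proof. by apply/esym/ginv_uniq; rewrite gmulA gmulK gmulVr. Qed.

End GroupLaws.

Definition grpE := (@ginvM, @ginvK, @ginv1, @gmulA, @gmul1l, @gmul1r, @gmulVl,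
  @gmulVr, @gmulK, @gmulVKr).

Section GroupTheory.
Variable G : Grp.
Implicit Types x y z t : G.

Lemma gmulV_eq1 x y : x^-1 * y = 1 -> x = y.
Proof. by move=> /ginv_uniq ->; rewrite ginvK. Qed.

Definition gcommute x y := x * y = y * x.

Lemma gcommute_sym x y : gcommute x y -> gcommute y x.
Proof. by []. Qed.

Lemma gcommuteM x y z : gcommute x y -> gcommute x z -> gcommute x (y * z).
Proof. by rewrite /gcommute => e f; rewrite gmulA e -gmulA f gmulA. Qed.

Lemma gcommuteV x y : gcommute x y -> gcommute x y^-1.
Proof.
rewrite /gcommute => e; apply: (@gmulI _ y); apply: (@gmulIr _ y).
by rewrite !gmulA gmulVKr gmulVr gmul1l.
Qed.

Lemma gcommute1 x : gcommute x 1.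
Proof. by rewrite /gcommute gmul1l gmul1r. Qed.

Lemma gcommuteX x y n : gcommute x y -> gcommute x (y ^+ n).
Proof.
by move=> e; elim: n => [|n IHn] /=; [exact: gcommute1|exact: gcommuteM].
Qed.

Lemma gpow1 x : x ^+ 1%N = x.
Proof. exact: gmul1r. Qed.

Lemma gpow_one n : (1 : G) ^+ n = 1.
Proof. by elim: n => //= n ->; rewrite gmul1l. Qed.

Lemma gpowS x n : x ^+ n.+1 = x * x ^+ n.
Proof. by []. Qed.

Lemma gpowSr x n : x ^+ n.+1 = x ^+ n * x.
Proof. by rewrite gpowS; apply: gcommuteX. Qed.

Lemma gpowD x m n : x ^+ (m + n)%N = x ^+ m * x ^+ n.
Proof. by elim: m => [|m IHm] /=; rewrite ?gmul1l // IHm gmulA. Qed.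

Lemma gpowM x m n : x ^+ (m * n)%N = (x ^+ m) ^+ n.
Proof. by elim: n => [|n IHn]; rewrite ?muln0 // mulnS gpowD IHn. Qed.

Lemma gpowV x n : x^-1 ^+ n = (x ^+ n)^-1.
Proof. by elim: n => [|n IHn]; rewrite ?ginv1 // gpowS IHn gpowSr ginvM. Qed.

Lemma gpowMc x y n : gcommute x y -> (x * y) ^+ n = x ^+ n * y ^+ n.
Proof.
move=> e; elim: n => [|n IHn] /=; first by rewrite gmul1l.
rewrite IHn !gmulA; congr (_ * _); rewrite -!gmulA; congr (_ * _).
exact/gcommuteX.
Qed.

Lemma gconjM t x y : gconj t (x * y) = gconj t x * gconj t y.
Proof. by rewrite /gconj !grpE. Qed.

Lemma gconj1 t : gconj t 1 = 1.
Proof. by rewrite /gconj !grpE. Qed.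

Lemma gconj1l x : gconj 1 x = x.
Proof. by rewrite /gconj !grpE. Qed.

Lemma gconjV t x : gconj t x^-1 = (gconj t x)^-1.
Proof. by rewrite /gconj !grpE. Qed.

Lemma gconjX t x n : gconj t (x ^+ n) = gconj t x ^+ n.
Proof. by elim: n => [|n IHn] /=; rewrite ?gconj1 // gconjM IHn. Qed.

Lemma gconjJ s t x : gconj s (gconj t x) = gconj (s * t) x.
Proof. by rewrite /gconj !grpE. Qed.

Lemma gconjK t x : gconj t^-1 (gconj t x) = x.
Proof. by rewrite gconjJ gmulVl gconj1l. Qed.

Lemma gconjKV t x : gconj t (gconj t^-1 x) = x.
Proof. by rewrite gconjJ gmulVr gconj1l. Qed.

Lemma gconj_inj t x y : gconj t x = gconj t y -> x = y.
Proof. by move=> e; rewrite -(gconjK t x) e gconjK. Qed.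

Lemma gconj_eq1 t x : gconj t x = 1 -> x = 1.
Proof. by rewrite -{1}(gconj1 t) => /gconj_inj. Qed.

Lemma gconj_commute t x : gcommute t x <-> gconj t x = x.
Proof.
rewrite /gcommute /gconj gmulA; split=> [->|e]; first by rewrite gmulK.
by rewrite -{2}e gmulVKr.
Qed.

Lemma gprod_cat (s t : seq G) : gprod (s ++ t) = gprod s * gprod t.
Proof. by elim: s => [|x s IHs] /=; rewrite ?gmul1l // -/(gprod _) IHs gmulA. Qed.

Lemma gprod_map_conj t (s : seq G) :
  gprod [seq gconj t x | x <- s] = gconj t (gprod s).
Proof. by elim: s => [|x s IHs] /=; rewrite ?gconj1 // gconjM -IHs. Qed.

Definition gpowz x (n : int) : G :=
  match n with Posz m => x ^+ m | Negz m => (x ^+ m.+1)^-1 end.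

Lemma gpowz_nat x (n : nat) : gpowz x n = x ^+ n.
Proof. by []. Qed.

Lemma gpowzN x n : gpowz x (- n)%R = (gpowz x n)^-1.
Proof. by case: n => [[|n]|n] //=; rewrite !grpE. Qed.

Lemma gcommutez x y n : gcommute x y -> gcommute x (gpowz y n).
Proof. by move=> e; case: n => n; [|apply: gcommuteV]; exact: gcommuteX. Qed.

Lemma gpowzS x n : gpowz x (1 + n)%R = x * gpowz x n.
Proof.
case: n => [n|[|n]] //; first by rewrite /= gmul1r gmulVr.
have -> : (1 + Negz n.+1)%R = Negz n by lia.
by rewrite /gpowz (gpowSr x n.+1) ginvM gmulKV.
Qed.

Lemma gpowzD x m n : gpowz x (m + n)%R = gpowz x m * gpowz x n.
Proof.
have H (k : nat) (l : int) : gpowz x (k%:Z + l)%R = x ^+ k * gpowz x l.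
  elim: k => [|k IHk]; first by rewrite add0r gmul1l.
  by rewrite intS -addrA gpowzS IHk gmulA.
case: m => m; first exact: H.
rewrite NegzE gpowzN gpowz_nat; apply: (@gmulI _ (x ^+ m.+1)).
by rewrite gmulKV -H addrA addrN add0r.
Qed.

Lemma gpowz1 n : gpowz (1 : G) n = 1.
Proof. by case: n => n; rewrite /gpowz gpow_one ?ginv1. Qed.

Lemma gpowzMn x m (n : nat) : gpowz x (m * n%:Z)%R = gpowz x m ^+ n.
Proof.
elim: n => [|n IHn]; first by rewrite mulr0.
by rewrite intS mulrDr mulr1 gpowzD IHn.
Qed.

Lemma gpowzM x m n : gpowz x (m * n)%R = gpowz (gpowz x m) n.
Proof.
case: n => n; first exact: gpowzMn.
by rewrite NegzE mulrN !gpowzN gpowzMn.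
Qed.

Lemma gpowzMc x y n : gcommute x y -> gpowz (x * y) n = gpowz x n * gpowz y n.
Proof.
move=> e; case: n => n; rewrite /gpowz gpowMc // ginvM.
by apply/gcommuteV/gcommute_sym/gcommuteV/gcommuteX/gcommute_sym/gcommuteX.
Qed.

Lemma gconjXz t x n : gconj t (gpowz x n) = gpowz (gconj t x) n.
Proof. by case: n => n; rewrite /gpowz ?gconjV gconjX. Qed.

End GroupTheory.

Section HomTheory.
Variables (G H : Grp) (f : G -> H).
Hypothesis fM : is_hom f.
Implicit Types x y : G.

Lemma hom1 : f 1 = 1.
Proof. by apply: (@gmulI _ (f 1)); rewrite -fM !gmul1r. Qed.

Lemma homV x : f x^-1 = (f x)^-1.
Proof. by apply: ginv_uniq; rewrite -fM gmulVr hom1. Qed.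

Lemma homX x n : f (x ^+ n) = f x ^+ n.
Proof. by elim: n => [|n IHn] /=; rewrite ?hom1 // fM IHn. Qed.

Lemma hom_conj x y : f (gconj x y) = gconj (f x) (f y).
Proof. by rewrite /gconj !fM homV. Qed.

Lemma hom_comm x y : f (gcomm x y) = gcomm (f x) (f y).
Proof. by rewrite /gcomm !fM !homV. Qed.

Lemma hom_prod (s : seq G) : f (gprod s) = gprod (map f s).
Proof. by elim: s => [|x s IHs] /=; rewrite ?hom1 // fM -IHs. Qed.

Lemma hom_cl_le gs k : cl_le gs k -> cl_le (map f gs) k.
Proof.
case=> ts [ps [sz [<- e]]]; exists (map f ts), [seq (f p.1, f p.2) | p <- ps].
rewrite !size_map sz; split=> //; split=> //.
have := congr1 f e; rewrite !hom_prod -!map_comp.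
have -> : map (f \o (fun p => gcomm p.1 p.2)) ps =
          map ((fun p => gcomm p.1 p.2) \o (fun p => (f p.1, f p.2))) ps.
  by apply: eq_map => p /=; rewrite hom_comm.
move=> <-; congr gprod; elim: ts gs {sz e} => [|t ts IHts] [|g gs] //=.
by rewrite IHts hom_conj.
Qed.

End HomTheory.

Lemma is_hom_comp (G H K : Grp) (g : H -> K) (f : G -> H) :
  is_hom g -> is_hom f -> is_hom (g \o f).
Proof. by move=> gM fM x y /=; rewrite fM gM. Qed.

(** * Groups with a Lyndon length function *)

(** The exponent [n] may vanish, so that 1 is commensurable with every [x]. The elements
    commensurable with [x] can then form a subgroup, but symmetry holds only away from 1. *)
Definition commensurable (G : Grp) (g x : G) :=
  exists m n, (0 < m)%N /\ (g ^+ m = x ^+ n \/ g ^+ m = (x ^+ n)^-1).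

Lemma commensurable_conj (G : Grp) (t g x : G) :
  commensurable (gconj t g) (gconj t x) -> commensurable g x.
Proof.
move=> [m [n [m0 e]]]; exists m, n; split=> //.
by case: e; rewrite -!gconjX -?gconjV => /gconj_inj ->; [left|right].
Qed.

Lemma commensurable_hom (G H : Grp) (f : G -> H) (fM : is_hom f) (g x : G) :
  commensurable g x -> commensurable (f g) (f x).
Proof.
move=> [m [n [m0 e]]]; exists m, n; split=> //.
by case: e; rewrite -!homX // => ->; [left|right; exact: homV].
Qed.

Definition unique_roots (G : Grp) := forall (x y : G) n, (0 < n)%N ->
  x ^+ n = y ^+ n -> x = y.

(** Excludes Baumslag-Solitar relations; [isolator_separated] turns it into malnormality of
    isolators. *)
Definition cyclic_normalizers (G : Grp) := forall (x g : G) k l, x <> 1 ->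
  (0 < k)%N -> gconj g (x ^+ k) = x ^+ l -> commensurable g x.

Section LyndonLength.
Variables (K : Grp) (L : K -> nat).

Definition ldist (x y : K) := L (x^-1 * y).

Hypothesis L1 : L 1 = 0%N.
Hypothesis LV : forall x, L x^-1 = L x.
(** The four-point condition of trees: of the three sums of distances between complementary pairs,
    the two largest agree. [L g] is the distance by which [g] moves the base point. *)
Hypothesis L4 : forall a b c e,
  (ldist a b + ldist c e <=
   maxn (ldist a c + ldist b e) (ldist a e + ldist b c))%N.

Local Notation d := ldist.
Implicit Types x y z g : K.

Lemma ldistC x y : d x y = d y x.
Proof. by rewrite /d -LV ginvM ginvK. Qed.

Lemma ldistxx x : d x x = 0%N.
Proof. by rewrite /d gmulVl. Qed.

Lemma ldist_mul z x y : d (z * x) (z * y) = d x y.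
Proof. by rewrite /d !grpE. Qed.

Lemma ldist1x x : d 1 x = L x.
Proof. by rewrite /d !grpE. Qed.

Lemma ldist_triangle x y z : (d x z <= d x y + d y z)%N.
Proof. by have := L4 x z y y; rewrite ldistxx (ldistC z y) maxnn addn0. Qed.

Lemma LM x y : (L (x * y) <= L x + L y)%N.
Proof.
have := ldist_triangle 1 x (x * y).
by rewrite !ldist1x; have := ldist_mul x 1 y; rewrite gmul1r ldist1x => ->.
Qed.

Lemma ldistX x i m : d (x ^+ i) (x ^+ (i + m)) = L (x ^+ m).
Proof. by rewrite /d gpowD gmulVK. Qed.

Lemma ldistX1 x i : d (x ^+ i) (x ^+ i.+1) = L x.
Proof. by rewrite -addn1 ldistX gpow1. Qed.

Lemma ldistXS x i : d x (x ^+ i.+1) = L (x ^+ i).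
Proof. by rewrite -{1}(gpow1 x) ldistX. Qed.

(** Stronger than having an axis: the base point lies on the axis, and [L x] is the translation
    length. *)
Definition hyperbolic x := (0 < L x)%N /\ L (x ^+ 2) = (2 * L x)%N.

Lemma hyperbolicX x k : hyperbolic x -> L (x ^+ k) = (k * L x)%N.
Proof.
case=> Lx Lx2; suff: L (x ^+ k) = (k * L x)%N /\ L (x ^+ k.+1) = (k.+1 * L x)%N.
  by case.
elim: k => [|k [IHk IHk1]]; first by rewrite L1 gpow1 mul1n.
split=> //; case: k IHk IHk1 => [|k] IHk IHk1; first exact: Lx2.
have := L4 1 (x ^+ k.+2) x (x ^+ k.+3); have := LM x (x ^+ k.+2).
rewrite -gpowS !ldist1x ldistX1 ldistXS ldistC (ldistXS x k.+1).
lia.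
Qed.

(** The assumption means translation length zero, so the orbit of the base point stays bounded. *)
Lemma elliptic_bounded x k : (L (x ^+ 2) <= L x)%N -> (L (x ^+ k) <= L x)%N.
Proof.
move=> Lx2; suff: (L (x ^+ k) <= L x)%N /\ (L (x ^+ k.+1) <= L x)%N by case.
elim: k => [|k [IHk IHk1]]; first by rewrite L1 gpow1.
split=> //; have := L4 1 x x^-1 (x ^+ k.+1).
rewrite !ldist1x ldistXS LV.
have -> : d x^-1 (x ^+ k.+1) = L (x ^+ k.+2) by rewrite /d ginvK -gpowS.
have -> : d x x^-1 = L (x ^+ 2).
  by rewrite /d -LV !grpE /= gmul1r.
lia.
Qed.

(** The difference [L (x ^+ 2) - L x] is the translation length; the remainder of [L x] is twice the
    distance from the base point to the axis. *)
Lemma nonelliptic_length x k : (L x < L (x ^+ 2))%N ->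
  L (x ^+ k.+1) = (L x + k * (L (x ^+ 2) - L x))%N.
Proof.
move=> Lx2; set t := (L (x ^+ 2) - L x)%N.
suff: L (x ^+ k.+1) = (L x + k * t)%N /\ L (x ^+ k.+2) = (L x + k.+1 * t)%N.
  by case.
elim: k => [|k [IHk IHk1]]; first by rewrite gpow1; split; lia.
split=> //.
have := L4 1 (x ^+ k.+2) x (x ^+ k.+3).
have := L4 1 (x ^+ k.+3) x (x ^+ k.+2).
rewrite !ldist1x ldistX1 !ldistXS (ldistC (x ^+ k.+3)) ldistX1.
rewrite (ldistC (x ^+ k.+2) x) (ldistC (x ^+ k.+3) x) !ldistXS.
move: IHk IHk1; rewrite !mulSn -/t; lia.
Qed.

(** Bounded powers exclude an elliptic [x]. A root has the same axis, and comparing the lengths of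
    [x ^+ n] and its square puts the base point on it. *)
Lemma hyperbolic_root x n : (0 < n)%N -> hyperbolic (x ^+ n) -> 
  hyperbolic x /\ (n * L x)%N = L (x ^+ n).
Proof.
case: n => // p _ hz; have [Lz _] := hz.
have [Lx2|Lx2] := leqP (L (x ^+ 2)) (L x).
  have := elliptic_bounded (p.+1 * (L x).+1) Lx2.
  rewrite gpowM (hyperbolicX _ hz); nia.
have Lz2 := hyperbolicX 2 hz; move: Lz2; rewrite -gpowM muln2.
have -> : (p.+1.*2 = (p + p.+1).+1)%N by lia.
rewrite (nonelliptic_length p Lx2) (nonelliptic_length (p + p.+1) Lx2).
set t := (L (x ^+ 2) - L x)%N => e.
have tE : t = L x by move: e; rewrite mulnDl; lia.
split; last by rewrite tE mulSn.
by split; move: Lx2 tE; rewrite /t; lia.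
Qed.

Lemma geodesic_point_unique a b p q :
  d a p = d a q -> d p b = d q b -> d a b = (d a p + d p b)%N -> d p q = 0%N.
Proof. by move=> e1 e2 e; have := L4 p q a b; rewrite !(ldistC _ a) e e1 e2; lia. Qed.

(** The two equations say that [z] fixes the base point and its translate by [w]. *)
Hypothesis acylindrical : forall z w,
  L z = 0%N -> L (w^-1 * (z * w)) = 0%N -> (1 < L w)%N -> z = 1.

(* [x ^+ i] and [y ^+ i] are the same point of the geodesic from 1 to a large
   power of [x ^+ n = y ^+ n], up to the stabilizer of the base point, so that
   [x^-1 * y] fixes points far apart. *)
Lemma hyperbolic_root_unique x y n : (0 < n)%N -> hyperbolic (x ^+ n) ->
  x ^+ n = y ^+ n -> x = y.
Proof.
move=> n0 hz e; have [hx lx] := hyperbolic_root n0 hz.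
have := hz; rewrite e => /(hyperbolic_root n0)[hy ly].
have lxy : L x = L y by move: lx ly; rewrite e; nia.
have D i : L ((x ^+ i)^-1 * y ^+ i) = 0%N.
  apply: (@geodesic_point_unique 1 (x ^+ (n * i))); rewrite ?ldist1x.
  - by rewrite !hyperbolicX // lxy.
  - have -> : (n * i)%N = (i + (n.-1 * i))%N by nia.
    rewrite ldistX.
    have -> : x ^+ (i + n.-1 * i)%N = y ^+ (i + n.-1 * i)%N.
      have -> : (i + n.-1 * i = n * i)%N by nia.
      by rewrite !gpowM e.
    by rewrite ldistX !hyperbolicX // lxy.
  - have -> : (n * i)%N = (i + (n.-1 * i))%N by nia.
    by rewrite ldistX !hyperbolicX //; nia.
have D' i : L ((y ^+ i)^-1 * ((x^-1 * y) * y ^+ i)) = 0%N.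
  have -> : (y ^+ i)^-1 * (x^-1 * y * y ^+ i) =
      ((x ^+ i)^-1 * y ^+ i)^-1 * ((x ^+ i.+1)^-1 * y ^+ i.+1).
    by rewrite !gpowS !grpE.
  apply/eqP; rewrite -leqn0; apply: leq_trans (LM _ _) _.
  by rewrite LV !D.
apply/gmulV_eq1/(@acylindrical _ (y ^+ 2)) => //.
- by have := D 1%N; rewrite !gpow1.
- by rewrite hyperbolicX //; case: hy; lia.
Qed.

Section Axis.
Variable z : K.
Hypothesis hz : hyperbolic z.

(** As [g] preserves the axis of [z], it moves the base point along it, between the translates by
    [z ^- i] and [z ^+ i]; the second summand is the distance to the former. *)
Lemma axis_sum g i : gcommute g z -> (L g < i * L z)%N ->
  (d g (z ^+ i) + L (z ^+ i * g) = 2 * (i * L z))%N.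
Proof.
move=> gz Lg; have gzi := gcommuteX i gz.
have := L4 1 (z ^+ i) g (z ^+ i * g); have := L4 1 (z ^+ i * g) g (z ^+ i).
have e1 : d g (z ^+ i * g) = L (z ^+ i) by rewrite /d -gzi gmulVK.
have e2 : d (z ^+ i) (z ^+ i * g) = L g by rewrite /d gmulVK.
rewrite !ldist1x e1 e2 (ldistC (z ^+ i * g) g) e1 (ldistC (z ^+ i * g)) e2.
rewrite (ldistC (z ^+ i) g) hyperbolicX //; lia.
Qed.

Lemma near_translate g : gcommute g z ->
  exists2 h, (exists j, h = gpowz z j * g) & (L h <= L z)%N.
Proof.
move=> gz; pose S n := `[< exists2 j, n = L (gpowz z j * g) & True >].
have S0 : exists n, S n by exists (L g); apply/asboolP; exists 0%R; rewrite ?gmul1l.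
have [n /asboolP[j -> _] minj] := ex_minnP S0; set h := gpowz z j * g in minj *.
exists h; first by exists j.
rewrite leqNgt; apply/negP => Lh.
have hzc : gcommute h z.
  apply/gcommute_sym/gcommuteM; last exact: gcommute_sym.
  exact: gcommutez.
have minh k : (L h <= L (gpowz z k * h))%N.
  apply: minj; apply/asboolP; exists (k + j)%R => //.
  by rewrite gpowzD -gmulA.
(* If the minimal length exceeded [L z], the four-point condition would keep [L (z ^+ i * h)]
   constant, against the linear growth of [L (z ^+ i)]. *)
suff Lc i : L (z ^+ i * h) = L h /\ L (z ^+ i.+1 * h) = L h.
  have [+ _] := Lc (2 * L h).+1; have := LM (z ^+ (2 * L h).+1 * h) h^-1.
  rewrite gmulK LV hyperbolicX //; case: hz; nia.
have step k : gcommute k z -> L k = L h -> (L h <= L (z * k))%N ->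
    (L h <= L (z^-1 * k))%N -> L (z * k) = L h.
  move=> kz Lk l1 l2; have := L4 1 (z * k) k z.
  have e1 : d k (z * k) = L z by rewrite /d -kz gmulVK.
  have e2 : d z (z * k) = L k by rewrite /d gmulVK.
  have e3 : d k z = L (z^-1 * k) by rewrite -LV /d !grpE.
  have := L4 1 k z (z * k).
  rewrite !ldist1x (ldistC (z * k) k) (ldistC (z * k) z) e1 e2 e3.
  lia.
elim: i => [|i [IHi IHi1]].
  split; first by rewrite gmul1l.
  rewrite gpow1; apply: step => //.
    by have := minh (Posz 1); rewrite gpowz_nat gpow1.
  by have := minh (- Posz 1)%R; rewrite gpowzN gpowz_nat gpow1.
split=> //; rewrite gpowS -gmulA; apply: step => //.
- apply/gcommute_sym/gcommuteM; last exact: gcommute_sym.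
  exact: gcommuteX.
- by have := minh (Posz i.+2); rewrite gpowz_nat gpowS -gmulA.
- by rewrite gpowS -gmulA gmulVK IHi.
Qed.

(* The translates of the powers of [g] back to a fundamental segment of the axis
   of [z] take finitely many positions. *)
Lemma axis_commensurable g : gcommute g z -> commensurable g z.
Proof.
move=> gz.
have H m : exists h, (exists j, h = gpowz z j * g ^+ m) /\ (L h <= L z)%N.
  have [|h] := @near_translate (g ^+ m).
    exact/gcommute_sym/gcommuteX/gcommute_sym.
  by exists h.
have /choice[h hP] := H.
have hz' m : gcommute (h m) z.
  have [[j ->] _] := hP m; apply/gcommute_sym/gcommuteM; first exact: gcommutez.
  exact/gcommuteX/gcommute_sym.
have Lz0 : (0 < L z)%N by case: hz.
have hsum m : (d (h m) (z ^+ 2) + L (z ^+ 2 * h m) = 4 * L z)%N.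
  rewrite axis_sum ?mulnA //; have [_] := hP m; lia.
pose f (m : 'I_(4 * L z).+2) : 'I_(4 * L z).+1 := inord (L (z ^+ 2 * h m)).
have /injectivePn[m [m' mm' ff]] : ~~ injectiveb f.
  by apply/negP => /injectiveP /leq_card; rewrite !card_ord ltnn.
wlog lt_mm : m m' mm' ff / (m < m')%N.
  move=> W; have [lt|lt|/val_inj e] := ltngtP m m'.
  - exact: (W m m').
  - by apply: (W m' m) => //; rewrite eq_sym.
  - by rewrite e eqxx in mm'.
have {}ff : L (z ^+ 2 * h m) = L (z ^+ 2 * h m').
  have hb k : (L (z ^+ 2 * h k)%grp < (4 * L z).+1)%N by have := hsum k; lia.
  by have := congr1 (@nat_of_ord _) ff; rewrite !inordK.
have hh : L ((h m)^-1 * h m') = 0%N.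
  have e (k : K) : d (z ^+ 2)^-1 k = L (z ^+ 2 * k) by rewrite /d ginvK.
  apply: (@geodesic_point_unique (z ^+ 2)^-1 (z ^+ 2)); rewrite ?e //.
    by have := hsum m; have := hsum m'; rewrite ff; lia.
  by rewrite -gpowD hyperbolicX // addnC hsum.
have hc : gcommute ((h m)^-1 * h m') z.
  by apply/gcommute_sym/gcommuteM; [apply: gcommuteV|]; exact/gcommute_sym/hz'.
(* This element fixes the base point and commutes with [z], so it also fixes the translate by
   [z ^+ 2], at distance [2 * L z > 1]. *)
have /gmulV_eq1 : (h m)^-1 * h m' = 1.
  apply: (@acylindrical _ (z ^+ 2)) => //.
    by rewrite (gcommuteX 2 hc) gmulVK.
  by rewrite hyperbolicX //; lia.
have [[j ->] _] := hP m; have [[j' ->] _] := hP m'.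
have -> : nat_of_ord m' = (m + (m' - m))%N by lia.
have -> : g ^+ (m + (m' - m)) = g ^+ (m' - m) * g ^+ m by rewrite addnC gpowD.
rewrite gmulA => /gmulIr e.
have {}e : g ^+ (m' - m) = gpowz z (- j' + j)%R by rewrite gpowzD e gpowzN gmulVK.
case: (- j' + j)%R e => n e; exists (m' - m)%N.
- by exists n; split; [lia|left].
- by exists n.+1; split; [lia|right].
Qed.

End Axis.

(** Conjugation by [g] changes lengths by at most [2 * L g], which is negligible on high powers;
    hence [k = l] and [g] commutes with [x ^+ k]. *)
Lemma hyperbolic_normalizer x g k l : hyperbolic x -> (0 < k)%N ->
  gconj g (x ^+ k) = x ^+ l -> commensurable g x.
Proof.
move=> hx k0 e.
have kl : k = l.
  apply/eqP; rewrite eqn_leq; apply/andP.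
  have ei i : gconj g (x ^+ (k * i)) = x ^+ (l * i) by rewrite !gpowM gconjX e.
  have Lx : (0 < L x)%N by case: hx.
  have bound i : (l * i * L x <= k * i * L x + 2 * L g)%N /\
                 (k * i * L x <= l * i * L x + 2 * L g)%N.
    split; rewrite -!(hyperbolicX _ hx).
      rewrite -ei /gconj; have := LM g (x ^+ (k * i) * g^-1).
      have := LM (x ^+ (k * i)) g^-1; rewrite LV; lia.
    have := congr1 (gconj g^-1) (ei i); rewrite gconjK => ->; rewrite /gconj.
    have := LM g^-1 (x ^+ (l * i) * g^-1^-1).
    have := LM (x ^+ (l * i)) g^-1^-1; rewrite !LV; lia.
  have [] := bound (2 * L g).+1; rewrite -!mulnA; set P := (_.+1 * L x)%N => b1 b2.
  have LP : (2 * L g < P)%N by rewrite /P mulSn; nia.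
  have cancel a b : (a * P <= b * P + 2 * L g)%N -> (a <= b)%N.
    move=> ab; rewrite leqNgt; apply/negP => /(leq_mul (leqnn P)).
    by rewrite mulnC (mulnC _ a) mulSn; lia.
  by split; apply: cancel.
have hz : hyperbolic (x ^+ k).
  case: (hx) => Lx _; split; rewrite -?gpowM !hyperbolicX //; lia.
have gz : gcommute g (x ^+ k) by apply/gconj_commute; rewrite e kl.
have [m [n [m0 H]]] := axis_commensurable hz gz.
by exists m, (k * n)%N; rewrite gpowM.
Qed.

End LyndonLength.

(** * Amalgams over a star of groups *)

Definition subgrp (G : Grp) (P : G -> Prop) :=
  [/\ P 1, forall x y, P x -> P y -> P (x * y) & forall x, P x -> P x^-1].

(** Equivalent elements have the same class as a predicate, by extensionality, so a choice depending
    only on the class and an irrelevant proof agrees on them. *)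
Lemma class_representatives (T : Type) (e : T -> T -> Prop) :
  (forall x, e x x) -> (forall x y, e x y -> e y x) ->
  (forall x y z, e x y -> e y z -> e x z) ->
  exists rep : T -> T, (forall x, e x (rep x)) /\
    (forall x y, e x y -> rep x = rep y).
Proof.
move=> er es et.
pose rep x := projT1 (cid (ex_intro (e x) x (er x))).
exists rep; split=> [x|x y exy]; first by rewrite /rep; case: cid.
have exyE : e x = e y.
  apply: funext => z; apply: propext; split=> [|H]; last exact: et H.
  by apply: et; apply: es.
rewrite /rep; move: (ex_intro _ x _) (ex_intro _ y _); rewrite exyE => p q.
by rewrite (Prop_irrelevance p q).
Qed.

Lemma transversal (G : Grp) (P : G -> Prop) : subgrp P ->
  exists r : G -> G, [/\ r 1 = 1, forall g, P (g * (r g)^-1) &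
    forall c g, P c -> r (c * g) = r g].
Proof.
case=> P1 PM PV.
have [||x y z Pxy Pyz|rep [repP repE]] :=
    @class_representatives G (fun g h => P (g * h^-1)).
- by move=> x; rewrite gmulVr.
- by move=> x y /PV; rewrite ginvM ginvK.
- by have := PM _ _ Pxy Pyz; rewrite gmulA gmulVKr.
exists (fun g => if `[< P g >] then 1 else rep g); split=> [|g|c g Pc].
- by case: asboolP.
- by case: asboolP => Pg; [rewrite ginv1 gmul1r|exact: repP].
- have -> : `[< P (c * g) >] = `[< P g >].
    apply/asboolP/asboolP => [H|]; last exact: PM.
    by have := PM _ _ (PV _ Pc) H; rewrite gmulVK.
  by case: asboolP => // _; apply: repE; rewrite gmulK.
Qed.

Section CommonPrefix.
Variable T : Type.
Implicit Types u v w : seq T.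

Fixpoint common_prefix u v : nat :=
  if u is x :: u' then
    if v is y :: v' then if `[< x = y >] then (common_prefix u' v').+1 else 0%N
    else 0%N
  else 0%N.

Lemma common_prefixC u v : common_prefix u v = common_prefix v u.
Proof.
elim: u v => [|x u IHu] [|y v] //=; rewrite IHu.
by congr (if _ then _ else _); apply/asboolP/asboolP.
Qed.

(** This ultrametric inequality becomes the four-point condition [alen4]. *)
Lemma common_prefix_ultra u v w :
  (minn (common_prefix u v) (common_prefix v w) <= common_prefix u w)%N.
Proof.
elim: u v w => [|x u IHu] [|y v] [|z w] //=; rewrite ?min0n ?minn0 //.
case: (asboolP (x = y)) => [<-|_]; last by rewrite min0n.
by case: asboolP => _; [rewrite minnSS ltnS; exact: IHu|rewrite minn0].
Qed.

Lemma common_prefix_cat u v w :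
  common_prefix (u ++ v) (u ++ w) = (size u + common_prefix v w)%N.
Proof. by elim: u => //= x u ->; case: asboolP. Qed.

Lemma common_prefix_catl u v w : (common_prefix u w < size u)%N ->
  common_prefix (u ++ v) w = common_prefix u w.
Proof.
elim: u w => [|x u IHu] [|y w] //=; case: asboolP => // _.
by rewrite ltnS => /IHu ->.
Qed.

End CommonPrefix.

(** * Normal forms in the amalgam and the actions of the factors *)

Section Amalgam.
Variables (G B : Grp) (I : Type).
(** A star of groups: centre [G], leaves [A i] inside one ambient group [B], and edge groups [C i]
    glued along [beta i], which is constrained only on [C i]. *)
Variables (C : I -> G -> Prop) (A : I -> B -> Prop) (beta : I -> G -> B).
Hypothesis C_subgrp : forall i, subgrp (C i).
Hypothesis A_subgrp : forall i, subgrp (A i).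
Hypothesis betaM : forall i c c', C i c -> C i c' ->
  beta i (c * c') = beta i c * beta i c'.
Hypothesis betaA : forall i c, C i c -> A i (beta i c).
Hypothesis beta_inj : forall i c c', C i c -> C i c' ->
  beta i c = beta i c' -> c = c'.

Let C1 i : C i 1. Proof. by case: (C_subgrp i). Qed.
Let CM i c c' : C i c -> C i c' -> C i (c * c').
Proof. by case: (C_subgrp i) => _ H _; apply: H. Qed.
Let CV i c : C i c -> C i c^-1.
Proof. by case: (C_subgrp i) => _ _ H; apply: H. Qed.
Let A1 i : A i 1. Proof. by case: (A_subgrp i). Qed.
Let AM i c c' : A i c -> A i c' -> A i (c * c').
Proof. by case: (A_subgrp i) => _ H _; apply: H. Qed.
Let AV i c : A i c -> A i c^-1.
Proof. by case: (A_subgrp i) => _ _ H; apply: H. Qed.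

Lemma beta1 i : beta i 1 = 1.
Proof.
have := betaM (C1 i) (C1 i); rewrite gmul1l => e.
by apply: (@gmulI _ (beta i 1)); rewrite -e gmul1r.
Qed.

Lemma betaV i c : C i c -> beta i c^-1 = (beta i c)^-1.
Proof.
by move=> Cc; apply: ginv_uniq; rewrite -betaM ?gmulVr ?beta1 //; apply: CV.
Qed.

Definition edge i b := exists2 c, C i c & b = beta i c.

Lemma edge_subgrp i : subgrp (edge i).
Proof.
split=> [|x y [c Cc ->] [c' Cc' ->]|x [c Cc ->]].
- by exists 1; rewrite ?beta1.
- by exists (c * c'); rewrite ?betaM //; apply: CM.
- by exists c^-1; rewrite ?betaV //; apply: CV.
Qed.

(** [r i] and [s i] choose representatives of the right cosets of [C i] in [G] and of its image in
    [A i]; [k i b] is the coefficient of [b] in [C i]. *)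
Variables (r : I -> G -> G) (s : I -> B -> B) (k : I -> B -> G).
Hypothesis r1 : forall i, r i 1 = 1.
Hypothesis rP : forall i g, C i (g * (r i g)^-1).
Hypothesis rC : forall i c g, C i c -> r i (c * g) = r i g.
Hypothesis s1 : forall i, s i 1 = 1.
Hypothesis sC : forall i c b, C i c -> s i (beta i c * b) = s i b.
Hypothesis kP : forall i b, A i b -> C i (k i b).
Hypothesis ksE : forall i b, A i b -> b = beta i (k i b) * s i b.

Definition kG i g := g * (r i g)^-1.

Lemma kGr i g : g = kG i g * r i g.
Proof. by rewrite /kG gmulVKr. Qed.

Lemma r_idem i g : r i (r i g) = r i g.
Proof. by rewrite [in RHS](kGr i g) rC //; apply: rP. Qed.

Lemma r_eq1 i g : r i g = 1 <-> C i g.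
Proof.
split=> [e|Cg]; first by have := rP i g; rewrite e ginv1 gmul1r.
by have := rC 1 Cg; rewrite gmul1r r1.
Qed.

Lemma As i b : A i b -> A i (s i b).
Proof.
move=> Ab; have -> : s i b = (beta i (k i b))^-1 * b.
  by rewrite {3}(ksE Ab) gmulVK.
by apply: AM => //; apply/AV/betaA/kP.
Qed.

Lemma s_idem i b : A i b -> s i (s i b) = s i b.
Proof. by move=> Ab; rewrite [in RHS](ksE Ab) sC //; apply: kP. Qed.

Lemma s_edge i b : edge i b -> s i b = 1.
Proof. by case=> c Cc ->; have := sC 1 Cc; rewrite gmul1r s1. Qed.

Lemma s_eq1 i b : A i b -> s i b = 1 -> edge i b.
Proof.
move=> Ab e; exists (k i b); first exact: kP.
by rewrite {1}(ksE Ab) e gmul1r.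
Qed.

Lemma k_uniq i b c b' : A i b -> C i c -> b = beta i c * b' -> s i b' = b' ->
  k i b = c /\ s i b = b'.
Proof.
move=> Ab Cc e sb'; have es : s i b = b' by rewrite e sC.
split=> //; apply: (@beta_inj i) => //; first exact: kP.
by apply: (@gmulIr _ b'); rewrite -e -{1}es -ksE.
Qed.

(* A normal form [(g, [:: (i1, b1, q1); (i2, b2, q2)])] stands for the product
   g b1 q1 b2 q2. *)
Definition syllables := seq (I * B * G).
Definition nform := (G * syllables)%type.

Definition first (l : syllables) : option I :=
  if l is (i, _, _) :: _ then Some i else None.

(** A representative [q <> 1] lies outside [C i], so the condition on equal consecutive indices
    forbids backtracking in the tree. *)
Fixpoint reduced (l : syllables) : Prop :=
  if l is (i, b, q) :: l' then
    [/\ A i b, s i b = b /\ b <> 1, r i q = q,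
      first l' = Some i -> q <> 1 & reduced l']
  else True.

(** These forms are a transversal for [A i]: every normal form is uniquely [a] times such a [t].
    [asplit] and [ajoin] are the two directions of this bijection, through which [A i] acts on
    normal forms (van der Waerden's method). *)
Definition areduced i (t : nform) :=
  [/\ r i t.1 = t.1, reduced t.2 & first t.2 = Some i -> t.1 <> 1].

Definition asplit i (w : nform) : B * nform :=
  if w.2 is (j, b, q) :: l' then
    if `[< j = i /\ C i w.1 >] then (beta i w.1 * b, (q, l'))
    else (beta i (kG i w.1), (r i w.1, w.2))
  else (beta i (kG i w.1), (r i w.1, w.2)).

Definition ajoin i (a : B) (t : nform) : nform :=
  if `[< s i a = 1 >] then (k i a * t.1, t.2)
  else (k i a, (i, s i a, t.1) :: t.2).

Lemma asplitP i (w : nform) : 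
  (exists b q l', [/\ w.2 = (i, b, q) :: l', C i w.1 &
    asplit i w = (beta i w.1 * b, (q, l'))]) \/
  [/\ first w.2 = Some i -> ~ C i w.1 &
    asplit i w = (beta i (kG i w.1), (r i w.1, w.2))].
Proof.
case: w => g [|[[j b] q] l']; first by right; split.
rewrite /asplit /=; case: asboolP => [[-> Cg]|H]; [left|right].
  by exists b, q, l'.
by split=> // -[ji] Cg; apply: H.
Qed.

Lemma asplit_ok i w : reduced w.2 ->
  areduced i (asplit i w).2 /\ A i (asplit i w).1.
Proof.
move=> Rw; have [[b [q [l' [e Cg ->]]]]|[H ->]] := asplitP i w.
  move: Rw; rewrite e /= => -[Ab _ rq Hq Rl']; split; first by split.
  by apply: AM => //; apply: betaA.
split; last exact/betaA/rP.
split=> //=; first exact: r_idem.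
by move=> /H H' /r_eq1.
Qed.

Lemma ajoin_ok i a t : A i a -> areduced i t -> reduced (ajoin i a t).2.
Proof.
move=> Aa [rt Rt Ht]; rewrite /ajoin; case: asboolP => //= sa.
by split=> //; [exact: As|split=> //; exact: s_idem].
Qed.

Lemma ajoinK i w : reduced w.2 -> ajoin i (asplit i w).1 (asplit i w).2 = w.
Proof.
case: w => g l /= Rw.
have [[b [q [l' [/= e Cg ->]]]]|[H ->]] := asplitP i (g, l); rewrite /ajoin /=.
  move: Rw; rewrite e /= => -[Ab [sb b1] rq Hq Rl'].
  have [|-> ->] := @k_uniq i (beta i g * b) g b _ Cg erefl sb.
    by apply: AM => //; apply: betaA.
  by case: asboolP.
have [||-> ->] := @k_uniq i (beta i (kG i g)) (kG i g) 1 _ (rP i g) _ (s1 i).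
- exact/betaA/rP.
- by rewrite gmul1r.
by case: asboolP => // _; rewrite -kGr.
Qed.

Lemma asplitK i a t : A i a -> areduced i t -> asplit i (ajoin i a t) = (a, t).
Proof.
case: t => q l Aa [/= rq Rl Hl]; rewrite /ajoin /=.
have Ck := kP Aa; case: asboolP => sa.
  have kGE : kG i (k i a * q) = k i a by rewrite /kG rC // rq gmulK.
  have aE : beta i (k i a) = a by rewrite [in RHS](ksE Aa) sa gmul1r.
  have [[b [q' [l' [/= e Cg _]]]]|[_ ->]] := asplitP i (k i a * q, l).
    case: Hl; first by rewrite e.
    rewrite -rq; apply/r_eq1; have := CM (CV Ck) Cg; by rewrite gmulVK.
  by rewrite /= kGE aE rC // rq.
have [[b [q' [l' [/= [<- <- <-] _ ->]]]]|[H _]] :=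
  asplitP i (k i a, (i, s i a, q) :: l); first by rewrite /= -ksE.
by case: H.
Qed.

Definition gact (g : G) (w : nform) : nform := (g * w.1, w.2).

Definition aact i a (w : nform) : nform :=
  if `[< A i a >] then ajoin i (a * (asplit i w).1) (asplit i w).2 else w.

Lemma aactE i a w : A i a ->
  aact i a w = ajoin i (a * (asplit i w).1) (asplit i w).2.
Proof. by rewrite /aact => Aa; case: asboolP. Qed.

Lemma aact_ok i a w : reduced w.2 -> reduced (aact i a w).2.
Proof.
move=> Rw; rewrite /aact; case: asboolP => // Aa.
by have [Rt At] := asplit_ok i Rw; apply: ajoin_ok => //; apply: AM.
Qed.

Lemma aactM i a a' w : A i a -> A i a' -> reduced w.2 ->
  aact i a (aact i a' w) = aact i (a * a') w.
Proof.
move=> Aa Aa' Rw; have [Rt At] := asplit_ok i Rw.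
rewrite !aactE ?asplitK ?gmulA //; exact: AM.
Qed.

Lemma aact1 i w : reduced w.2 -> aact i 1 w = w.
Proof. by move=> Rw; rewrite aactE // gmul1l ajoinK. Qed.

Lemma asplit_areduced i t : areduced i t -> asplit i t = (1, t).
Proof.
move=> Rt; rewrite -[RHS](asplitK (A1 i) Rt); congr asplit.
have [|k1 s1'] := @k_uniq i 1 1 1 (A1 i) (C1 i) _ (s1 i).
  by rewrite beta1 gmul1l.
by rewrite /ajoin; case: asboolP => // _; rewrite k1 gmul1l; case: (t).
Qed.

Lemma gactM g h w : gact g (gact h w) = gact (g * h) w.
Proof. by rewrite /gact gmulA. Qed.

Lemma gact1 w : gact 1 w = w.
Proof. by case: w => g l; rewrite /gact gmul1l. Qed.

Lemma asplit_gact i c w : C i c ->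
  asplit i (gact c w) = (beta i c * (asplit i w).1, (asplit i w).2).
Proof.
move=> Cc; have [[b [q [l' [e Cg ->]]]]|[H ->]] := asplitP i w;
have [[b' [q' [l'' [/= e' Cg' ->]]]]|[H' ->]] := asplitP i (gact c w).
- by move: e'; rewrite e /= => -[-> -> ->]; rewrite betaM // gmulA.
- by case: H'; rewrite /= ?e //; apply: CM.
- case: H; first by rewrite e'.
  by have := CM (CV Cc) Cg'; rewrite gmulVK.
- by rewrite /= rC // -betaM /kG ?rC ?gmulA //; apply: rP.
Qed.

(** The actions of [A i] and [G] agree on the edge group, as the amalgam requires. *)
Lemma aact_beta i c w : C i c -> reduced w.2 -> aact i (beta i c) w = gact c w.
Proof.
move=> Cc Rw; rewrite aactE; last exact: betaA.
by rewrite -[RHS](@ajoinK i) // asplit_gact.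
Qed.

(** * The group of normal forms *)

Fixpoint lmul (l : syllables) (w : nform) : nform :=
  if l is (i, b, q) :: l' then aact i b (gact q (lmul l' w)) else w.
Definition nmul (x y : nform) : nform := gact x.1 (lmul x.2 y).
Definition none : nform := (1, [::]).
Definition nA i a : nform := aact i a none.

Lemma lmul_ok l w : reduced w.2 -> reduced (lmul l w).2.
Proof. by move=> Rw; elim: l => [|[[i b] q] l IHl] //=; exact: aact_ok. Qed.

Lemma nmul_ok x y : reduced y.2 -> reduced (nmul x y).2.
Proof. exact: lmul_ok. Qed.

Lemma nmul_gact g x y : nmul (gact g x) y = gact g (nmul x y).
Proof. by rewrite /nmul gactM. Qed.

Lemma nmul_asplit i x y : reduced x.2 -> reduced y.2 ->
  nmul x y = aact i (asplit i x).1 (nmul (asplit i x).2 y).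
Proof.
move=> Rx Ry; have [[b [q [l' [e Cg ->]]]]|[H ->]] := asplitP i x.
  rewrite /nmul e /=; move: Rx; rewrite e /= => -[Ab _ _ _ _].
  rewrite -aactM ?aact_beta //; do ?[exact: lmul_ok|exact/aact_ok/lmul_ok].
  exact: betaA.
rewrite /nmul /= aact_beta; [|exact: rP|exact: lmul_ok].
by rewrite gactM -kGr.
Qed.

(** Right multiplication is equivariant for the left actions; associativity then follows by
    induction on the syllables of the first factor. *)
Lemma nmul_aact i a x y : A i a -> reduced x.2 -> reduced y.2 ->
  nmul (aact i a x) y = aact i a (nmul x y).
Proof.
move=> Aa Rx Ry; have [Rt At] := asplit_ok i Rx.
have Aa' := AM Aa At.
have e : asplit i (aact i a x) = (a * (asplit i x).1, (asplit i x).2).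
  by rewrite aactE // asplitK.
rewrite (nmul_asplit i Rx Ry) aactM //; last exact: nmul_ok.
by rewrite (@nmul_asplit i) ?e //; exact: aact_ok.
Qed.

Lemma nmulA x y z : reduced x.2 -> reduced y.2 -> reduced z.2 ->
  nmul x (nmul y z) = nmul (nmul x y) z.
Proof.
case: x => g l /= Rl Ry Rz.
rewrite /(nmul (g, l) _) [nmul (nmul (g, l) y) z]nmul_gact; congr gact.
elim: l Rl => [|[[i b] q] l IHl] //= [Ab _ _ _ Rl].
rewrite nmul_aact ?nmul_gact ?IHl //; exact: lmul_ok.
Qed.

Lemma nmul1x x : nmul none x = x.
Proof. exact: gact1. Qed.

Lemma aact_cons i b t : A i b -> s i b = b /\ b <> 1 -> areduced i t ->
  aact i b t = (1, (i, b, t.1) :: t.2).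
Proof.
move=> Ab [sb b1] Rt; rewrite aactE // asplit_areduced //= gmul1r.
have [|kb _] := @k_uniq i b 1 b Ab (C1 i) _ sb; first by rewrite beta1 gmul1l.
by rewrite /ajoin sb kb; case: asboolP.
Qed.

Lemma nmulx1 x : reduced x.2 -> nmul x none = x.
Proof.
case: x => g l /= Rl; rewrite /nmul /=.
suff -> : lmul l none = (1, l) by rewrite /gact gmul1r.
elim: l Rl => [|[[i b] q] l IHl] //= [Ab sb rq Hq Rl].
by rewrite IHl // /gact gmul1r aact_cons.
Qed.

Lemma nmul_nA i a x : A i a -> reduced x.2 -> nmul (nA i a) x = aact i a x.
Proof. by move=> Aa Rx; rewrite nmul_aact // nmul1x. Qed.

Fixpoint linv (l : syllables) : nform :=
  if l is (i, b, q) :: l' then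
    nmul (linv l') (nmul (q^-1, [::]) (nA i b^-1))
  else none.
Definition ninv (x : nform) := nmul (linv x.2) (x.1^-1, [::]).

Lemma nA_ok i a : reduced (nA i a).2.
Proof. exact: aact_ok. Qed.

Lemma linv_ok l : reduced (linv l).2.
Proof. by case: l => [|[[i b] q] l] //=; do 2!apply: nmul_ok; exact: nA_ok. Qed.

Lemma linvK l x : reduced l -> reduced x.2 -> nmul (linv l) (lmul l x) = x.
Proof.
move=> Rl Rx; elim: l Rl => [|[[i b] q] l IHl] /=; first by rewrite nmul1x.
move=> [Ab _ _ _ Rl]; have Ry : reduced (gact q (lmul l x)).2 by apply: lmul_ok.
have RA := nA_ok i b^-1.
rewrite -!nmulA ?nmul_nA ?aactM ?gmulVl ?aact1 //; do ?exact: AV;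
  do ?[exact: linv_ok|exact: aact_ok|exact: nmul_ok].
by rewrite {2}/nmul /= gactM gmulVl gact1 IHl.
Qed.

Lemma nmulVx x : reduced x.2 -> nmul (ninv x) x = none.
Proof.
move=> Rx; rewrite -nmulA //; last exact: linv_ok.
have -> : nmul (x.1^-1, [::]) x = lmul x.2 none.
  by rewrite -{2}(nmulx1 Rx) /nmul /= gactM gmulVl gact1.
exact: linvK.
Qed.

Lemma ninv_ok x : reduced (ninv x).2.
Proof. exact: nmul_ok. Qed.

Lemma nmulxV x : reduced x.2 -> nmul x (ninv x) = none.
Proof.
move=> Rx; have Rv := ninv_ok x; have Rvv := ninv_ok (ninv x).
have xE : x = ninv (ninv x).
  by rewrite -(nmulx1 Rvv) -(nmulVx Rx) nmulA // nmulVx // nmul1x.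
by rewrite {1}xE nmulVx.
Qed.

Definition amalgam_car := {x : nform | reduced x.2}.
Definition amk x Rx : amalgam_car := exist _ x Rx.

Lemma amalgam_eq (x y : amalgam_car) : sval x = sval y -> x = y.
Proof. by case: x y => [x Rx] [y Ry] /= e; exact: eq_exist. Qed.

Definition amalgam : Grp.
Proof.
apply: (@MkGroup amalgam_car
  (fun x y => amk (nmul_ok (sval x) (svalP y))) (@amk none Logic.I)
  (fun x => amk (ninv_ok (sval x)))).
- by move=> [x Rx] [y Ry] [z Rz]; apply: amalgam_eq; exact: nmulA.
- by move=> [x Rx]; apply: amalgam_eq; exact: nmul1x.
- by move=> [x Rx]; apply: amalgam_eq; exact: nmulx1.
- by move=> [x Rx]; apply: amalgam_eq; exact: nmulVx.
- by move=> [x Rx]; apply: amalgam_eq; exact: nmulxV.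
Defined.


Lemma amalgam_mulE (x y : amalgam) : sval (x * y) = nmul (sval x) (sval y).
Proof. by []. Qed.

Lemma G_ok g : reduced ((g, [::]) : nform).2. Proof. by []. Qed.
Definition inG g : amalgam := amk (G_ok g).
Definition inA i a : amalgam := amk (nA_ok i a).

Lemma inGE g (x : amalgam) : sval (inG g * x) = gact g (sval x).
Proof. by []. Qed.

Lemma inAE i a (x : amalgam) : A i a -> sval (inA i a * x) = aact i a (sval x).
Proof. by move=> Aa; rewrite amalgam_mulE nmul_nA //; exact: (proj2_sig x). Qed.

Lemma inGM : is_hom inG.
Proof. by move=> g h; apply: amalgam_eq. Qed.

Lemma inAM i a a' : A i a -> A i a' -> inA i (a * a') = inA i a * inA i a'.
Proof. by move=> Aa Aa'; apply: amalgam_eq; rewrite inAE //= /nA aactM. Qed.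

Lemma inA_beta i c : C i c -> inA i (beta i c) = inG c.
Proof.
by move=> Cc; apply: amalgam_eq; rewrite /= /nA aact_beta // /gact gmul1r.
Qed.

Lemma inG1 : inG 1 = 1. Proof. exact: amalgam_eq. Qed.

Lemma inG_inj g h : inG g = inG h -> g = h.
Proof. by move=> /(congr1 sval) []. Qed.

Lemma inA1 i : inA i 1 = 1.
Proof. by rewrite -(beta1 i) inA_beta // inG1. Qed.

Lemma inAV i a : A i a -> inA i a^-1 = (inA i a)^-1.
Proof.
by move=> Aa; apply: ginv_uniq; rewrite -inAM ?gmulVr ?inA1 //; exact: AV.
Qed.

Lemma AX i a n : A i a -> A i (a ^+ n).
Proof. by move=> Aa; elim: n => //= n IHn; exact: AM. Qed.

Lemma inAX i a n : A i a -> inA i (a ^+ n) = inA i a ^+ n.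
Proof.
move=> Aa; elim: n => [|n IHn] /=; first exact: inA1.
by rewrite inAM ?IHn //; exact: AX.
Qed.

Lemma none_areduced i : areduced i none.
Proof. by split=> //=; rewrite r1. Qed.

Lemma inA_inj i a a' : A i a -> A i a' -> inA i a = inA i a' -> a = a'.
Proof.
move=> Aa Aa' /(congr1 sval) /= /(congr1 (asplit i)); rewrite /nA !aactE //.
have Rn := none_areduced i.
by rewrite (asplit_areduced Rn) !gmul1r !asplitK // => -[].
Qed.

(** * Universal property of the amalgam *)

Section Universal.
Variables (W : Grp) (phi : G -> W) (psi : I -> B -> W).
Hypothesis phiM : is_hom phi.
Hypothesis psiM : forall i a a', A i a -> A i a' ->
  psi i (a * a') = psi i a * psi i a'.
Hypothesis phi_psi : forall i c, C i c -> psi i (beta i c) = phi c.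

Fixpoint lift_syll (l : syllables) : W :=
  if l is (i, b, q) :: l' then psi i b * (phi q * lift_syll l') else 1.
Definition nlift (x : nform) : W := phi x.1 * lift_syll x.2.

Lemma nlift_gact g x : nlift (gact g x) = phi g * nlift x.
Proof. by rewrite /nlift phiM gmulA. Qed.

Lemma nlift_asplit i x : reduced x.2 ->
  nlift x = psi i (asplit i x).1 * nlift (asplit i x).2.
Proof.
move=> Rx; have [[b [q [l' [e Cg ->]]]]|[H ->]] := asplitP i x.
  move: Rx; rewrite e /= => -[Ab _ _ _ _].
  by rewrite /nlift e /= psiM ?phi_psi ?gmulA //; exact: betaA.
by rewrite /nlift /= phi_psi ?gmulA -?phiM -?kGr //; exact: rP.
Qed.

Lemma nlift_aact i a x : A i a -> reduced x.2 ->
  nlift (aact i a x) = psi i a * nlift x.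
Proof.
move=> Aa Rx; have [Rt At] := asplit_ok i Rx.
rewrite (nlift_asplit i Rx) gmulA -psiM // aactE //.
move: (asplit i x) Rt At => [a' t] /= Rt At.
move: (a * a') (AM Aa At) => d Ad; have Ck := kP Ad.
have -> : psi i d = phi (k i d) * psi i (s i d).
  by rewrite {1}(ksE Ad) psiM ?phi_psi //; [exact: betaA|exact: As].
rewrite /ajoin; case: asboolP => [->|_]; last by rewrite /nlift /= !gmulA.
have psi1 : psi i 1 = 1 by rewrite -(beta1 i) phi_psi // (hom1 phiM).
by rewrite nlift_gact psi1 gmul1r; case: (t).
Qed.

Lemma nlift_nmul x y : reduced x.2 -> reduced y.2 ->
  nlift (nmul x y) = nlift x * nlift y.
Proof.
case: x => g l /= Rl Ry; rewrite /nmul nlift_gact /= [nlift (g, l)]/nlift.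
rewrite -gmulA; congr (_ * _).
elim: l Rl => [|[[i b] q] l IHl] /=; first by rewrite gmul1l.
move=> [Ab _ _ _ Rl]; rewrite nlift_aact ?nlift_gact ?IHl ?gmulA //.
exact: lmul_ok.
Qed.

Lemma amalgam_universal : exists Phi : amalgam -> W,
  [/\ is_hom Phi, forall g, Phi (inG g) = phi g &
      forall i a, A i a -> Phi (inA i a) = psi i a].
Proof.
exists (fun x => nlift (sval x)); split=> [[x Rx] [y Ry]|g|i a Aa].
- exact: nlift_nmul.
- exact: gmul1r.
- by rewrite /= nlift_aact // /nlift /= (hom1 phiM) !gmul1r.
Qed.

End Universal.

(** * Syllable length as distance in the Bass-Serre tree *)

Lemma edge_mulr i b d : edge i d -> edge i (b * d) -> edge i b.
Proof.
have [_ EM EV] := edge_subgrp i.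
by move=> Ed Ebd; rewrite -(gmulK d b); apply: EM => //; exact: EV.
Qed.

Lemma reduced_not_edge i b : s i b = b /\ b <> 1 -> ~ edge i b.
Proof. by move=> [sb b1] /s_edge; rewrite sb. Qed.

Lemma aact_grow i a w : A i a -> ~ edge i a ->
    (first w.2 = Some i -> ~ C i w.1) ->
  exists a', aact i a w = (k i a', (i, s i a', r i w.1) :: w.2) /\ A i a'.
Proof.
move=> Aa Ea H; have [[b [q [l' [e Cg _]]]]|[_ e]] := asplitP i w.
  by case: H => //; rewrite e.
have Ak := betaA (rP i w.1).
exists (a * beta i (kG i w.1)); rewrite aactE // e /ajoin /=.
split; last exact: AM.
case: asboolP => // /(s_eq1 (AM Aa Ak)) E; case: Ea; apply: edge_mulr E.
by exists (kG i w.1) => //; exact: rP.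
Qed.

(* The vertices of the Bass-Serre tree on the geodesic from the coset [G] to the
   coset of a normal form, listed from the root: the last syllable comes first. *)
Fixpoint treepath (l : syllables) : seq (B + I * G) :=
  if l is (i, b, q) :: l' then treepath l' ++ [:: inr (i, q); inl b] else [::].

Lemma size_treepath l : size (treepath l) = (2 * size l)%N.
Proof. by elim: l => [|[[i b] q] l IHl] //=; rewrite size_cat IHl /=; lia. Qed.

Lemma treepath_cat l m : treepath (l ++ m) = treepath m ++ treepath l.
Proof.
by elim: l => [|[[i b] q] l IHl] /=; rewrite ?cats0 // IHl catA.
Qed.

Definition meet l m := common_prefix (treepath l) (treepath m).

(* The possible positions of [(q, l) * y] relative to [y]: no syllable was
   consumed yet, the last step consumed a syllable of [y], or the path of the
   product has left the path of [y]. *)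
Definition mul_state (q : G) (l : syllables) (y w : nform) : Prop :=
  [\/ l = [::] /\ w.2 = y.2,
      exists i b' q' m1 c, [/\ first l = Some i, C i c, w.1 = q * c * q',
        y.2 = m1 ++ (i, b', q') :: w.2 & size l = (size m1).+1] |
      exists i c, [/\ first l = Some i /\ first w.2 = Some i, C i c, w.1 = q * c,
        (size l + meet w.2 y.2 = size w.2 + size y.2)%N &
        (meet w.2 y.2 < 2 * size w.2)%N]].

Lemma mul_stateP q l y : reduced l -> reduced y.2 ->
  mul_state q l y (nmul (q, l) y).
Proof.
move=> Rl Ry; elim: l q Rl => [|[[i b] q] l IHl] g /=; first by constructor 1.
move=> [Ab sb rq Hq Rl]; have Eb := reduced_not_edge sb.
have -> : nmul (g, (i, b, q) :: l) y = gact g (aact i b (nmul (q, l) y)) by [].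
move: (nmul (q, l) y) (nmul_ok (q, l) Ry) (IHl q Rl) => w Rw Sw {IHl}.
(* As the multiplying word is reduced, its next syllable cannot merge with the one just produced:
   once the paths have separated, no further syllable is consumed. *)
have qC c : first l = Some i -> C i c -> ~ C i (q * c).
  move=> /Hq q1 Cc /CM /(_ (CV Cc)); rewrite gmulK => /r_eq1.
  by rewrite rq.
have [[b' [q' [t' [e Cg es]]]]|[H _]] := asplitP i w; last first.
  have [a' [-> Aa']] := aact_grow Ab Eb H; constructor 3; exists i, (k i a').
  case: Sw => [[l0 wy]|[j [b' [q' [m1 [c [lj Cc we ye sl]]]]]]|
               [j [c [[lj wj] Cc we ee lt]]]].
  - have m2 : meet ((i, s i a', r i w.1) :: w.2) y.2 = (2 * size w.2)%N.
      rewrite -wy /meet /= -[X in common_prefix _ X]cats0 common_prefix_cat.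
      by rewrite size_treepath addn0.
    split=> //=; [exact: kP|rewrite m2 l0 wy /=; lia|rewrite m2 /=; lia].
  - have m2 : meet ((i, s i a', r i w.1) :: w.2) y.2 = (2 * size w.2)%N.
      rewrite ye /meet /= treepath_cat /= -catA common_prefix_cat size_treepath.
      rewrite /=; case: asboolP => [[ij rq']|_] /=; last by rewrite addn0.
      rewrite -ij in lj Cc; case: (qC c lj Cc).
      by have := rP i w.1; rewrite rq' we gmulK.
    by split=> //=; [exact: kP|rewrite m2 ye size_cat /= sl; lia|
      rewrite m2 /=; lia].
  - have lt' : (common_prefix (treepath w.2) (treepath y.2) < size (treepath w.2))%N.
      by rewrite size_treepath.
    have m2 : meet ((i, s i a', r i w.1) :: w.2) y.2 = meet w.2 y.2.
      by rewrite /meet /= common_prefix_catl.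
    by split=> //=; [exact: kP|rewrite m2; lia|rewrite m2 /=; lia].
have Aa : A i (b * (beta i w.1 * b')).
  by have [_] := asplit_ok i Rw; rewrite es /= => ?; exact: AM.
move: (Rw); rewrite e /= => -[Ab' sb' rq' _ _].
rewrite aactE // es /ajoin /=; case: asboolP => sa.
  constructor 2; exists i, b', q'.
  have Ck := kP Aa; set c' := k i _ in Ck *.
  case: Sw => [[l0 wy]|[j [b'' [q'' [m1 [c [lj Cc we ye sl]]]]]]|
             [j [c [[lj wj] Cc we ee lt]]]]; last first.
  - case: (qC c); [|by move: wj Cc; rewrite e => -[->]|by rewrite -we].
    by rewrite lj -wj e.
  - exists (rcons m1 (j, b'', q'')), c'; split=> //=; first by rewrite gmulA.
      by rewrite ye e -cats1 -catA.
    by rewrite size_rcons sl.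
  - exists [::], c'; split=> //=; first by rewrite gmulA.
      by rewrite -wy e.
    by rewrite l0.
constructor 3; exists i, (k i (b * (beta i w.1 * b'))).
have sb2 : s i (b * (beta i w.1 * b')) <> b'.
  move=> sE; case: Eb; apply: (@edge_mulr _ _ (beta i w.1)); first by exists w.1.
  exists (k i (b * (beta i w.1 * b'))); first exact: kP.
  by apply: (@gmulIr _ b'); rewrite -gmulA [LHS](ksE Aa) sE.
have m2 u : meet ((i, s i (b * (beta i w.1 * b')), q') :: t') (u ++ w.2)
    = (2 * size t').+1.
  rewrite e /meet treepath_cat /= -catA common_prefix_cat size_treepath /=.
  case: asboolP => //= _; case: asboolP => [[]//|_]; lia.
have sw : size w.2 = (size t').+1 by rewrite e.
case: Sw => [[l0 wy]|[j [b'' [q'' [m1 [c [lj Cc we ye sl]]]]]]|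
             [j [c [[lj wj] Cc we ee lt]]]]; last first.
- case: (qC c); [|by move: wj Cc; rewrite e => -[->]|by rewrite -we].
  by rewrite lj -wj e.
- split=> //=; first exact: kP.
    by rewrite ye -cat_rcons m2 size_cat size_rcons sw sl; lia.
  by rewrite ye -cat_rcons m2; lia.
- split=> //=; first exact: kP.
    by rewrite -wy -[w.2]cat0s m2 /= sw l0 /=; lia.
  by rewrite -wy -[w.2]cat0s m2; lia.
Qed.

Definition alen (x : amalgam) : nat := size (sval x).2.

(** In the tree of right cosets, [2 * alen z] is the distance between the vertices of [z * y] and
    [y], and [meet] is the length of the common initial part of their geodesics from the root. *)
Lemma alen_mul (z y : amalgam) :
  (alen z + meet (sval (z * y)%grp).2 (sval y).2 = alen (z * y)%grp + alen y)%N.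
Proof.
case: z y => -[g l] Rl [y Ry]; rewrite /alen amalgam_mulE /=.
have := @mul_stateP 1 l y Rl Ry; rewrite -[(lmul l y).2]/(nmul (1, l) y).2.
move: (nmul (1, l) y) => w.
case=> [[-> ->]|[i [b' [q' [m1 [c [_ _ _ -> ->]]]]]]|[i [c [_ _ _ -> _]]]] //=.
  rewrite /meet -[treepath y.2]cats0 common_prefix_cat size_treepath /=; lia.
rewrite /meet treepath_cat -{1}[treepath w.2]cats0 /= -!catA common_prefix_cat.
rewrite size_treepath size_cat /=; lia.
Qed.


Lemma alen1 : alen 1 = 0%N. Proof. by []. Qed.

Lemma alenV (x : amalgam) : alen x^-1 = alen x.
Proof. by have := alen_mul x^-1 x; rewrite gmulVl alen1 /= addn0. Qed.

Lemma alen4 (a b c e : amalgam) :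
  (ldist alen a b + ldist alen c e <=
   maxn (ldist alen a c + ldist alen b e) (ldist alen a e + ldist alen b c))%N.
Proof.
(* With [a] moved to the root, [meet] is a Gromov product; the inverses pass from left to right
   cosets. *)
have dE (x y : amalgam) : (ldist alen x y +
    meet (sval (a^-1 * x)^-1%grp).2 (sval (a^-1 * y)^-1%grp).2 =
    ldist alen a x + ldist alen a y)%N.
  have := alen_mul ((a^-1 * x)^-1 * (a^-1 * y)) (a^-1 * y)^-1.
  by rewrite gmulK !alenV /ldist !grpE.
have := dE c e; have := dE b e; have := dE b c.
have := common_prefix_ultra (treepath (sval (a^-1 * c)^-1%grp).2)
  (treepath (sval (a^-1 * b)^-1%grp).2) (treepath (sval (a^-1 * e)^-1%grp).2).
rewrite (common_prefixC (treepath (sval (a^-1 * c)^-1%grp).2)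
  (treepath (sval (a^-1 * b)^-1%grp).2)).
rewrite /meet; lia.
Qed.

Lemma alenM (x y : amalgam) : (alen (x * y)%grp <= alen x + alen y)%N.
Proof. exact: (LM alen1 alenV alen4). Qed.

Lemma alen_inG g : alen (inG g) = 0%N. Proof. by []. Qed.

Lemma alen0 (x : amalgam) : alen x = 0%N -> exists g, x = inG g.
Proof.
case: x => -[g l] Rl /size0nil /= l0; exists g; apply: amalgam_eq => /=.
by rewrite l0.
Qed.

Lemma alen_mull (z x : amalgam) : alen z = 0%N -> alen (z * x)%grp = alen x.
Proof. by move=> /alen0[g ->]. Qed.

Lemma alen_mulr (z x : amalgam) : alen z = 0%N -> alen (x * z)%grp = alen x.
Proof.
by move=> z0; rewrite -alenV ginvM alen_mull ?alenV // alenV.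
Qed.

Definition no_merge i (x : amalgam) := first (sval x).2 = Some i -> ~ C i (sval x).1.

Lemma alen_grow i a (x : amalgam) : A i a -> ~ edge i a -> no_merge i x ->
  alen (inA i a * x)%grp = (alen x).+1.
Proof.
by move=> Aa Ea Hx; rewrite /alen inAE //; have [a' [-> _]] := aact_grow Aa Ea Hx.
Qed.

Lemma areduced_no_merge i t : areduced i t ->
  first t.2 = Some i -> ~ C i t.1.
Proof. by move=> [rt _ Ht] /Ht t1 /r_eq1; rewrite rt. Qed.

Lemma edge_inA i a : edge i a -> exists2 c, C i c & inA i a = inG c.
Proof. by case=> c Cc ->; exists c => //; rewrite inA_beta. Qed.

Lemma no_merge_GA j i g b : A i b -> ~ edge i b ->
  no_merge j (inG g * inA i b) \/ i = j /\ C i g.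
Proof.
move=> Ab Eb; have nA0 : no_merge i (1 : amalgam) by [].
have [b' [e Ab']] := aact_grow Ab Eb nA0.
have := pselect (i = j /\ C i g); case=> [|H]; first by right.
left; rewrite /no_merge inGE -[inA i b]gmul1r (inAE _ Ab) e /= => -[ij] Cg.
apply: H; split=> //; subst j.
by have := CM Cg (CV (kP Ab')); rewrite gmulK.
Qed.

Definition aminimal i (x : amalgam) := forall a, A i a -> ~ edge i a ->
  alen (inA i a * x)%grp = (alen x).+1.

Lemma amalgam_split i (x : amalgam) : aminimal i x \/
  exists a y, [/\ A i a, x = inA i a * y & alen x = (alen y).+1].
Proof.
have [Rt At] := asplit_ok i (proj2_sig x).
have [_ Rt2 _] := Rt; pose y : amalgam := amk Rt2.
have xE : x = inA i (asplit i (sval x)).1 * y.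
  apply: amalgam_eq; rewrite inAE // aactE // (asplit_areduced Rt) gmul1r /=.
  by rewrite ajoinK //; exact: (proj2_sig x).
have ny : no_merge i y by exact: (areduced_no_merge Rt).
have [Ea|Ea] := pselect (edge i (asplit i (sval x)).1).
  left=> a Aa Ea'; have [c Cc ec] := edge_inA Ea.
  rewrite {1}xE gmulA -inAM // alen_grow //; first by rewrite xE ec.
    exact: AM.
  by move=> /(edge_mulr Ea).
by right; exists (asplit i (sval x)).1, y; split=> //; rewrite {1}xE alen_grow.
Qed.

Lemma amalgam_front (x : amalgam) : (0 < alen x)%N -> exists i b w,
  [/\ first (sval x).2 = Some i, A i b /\ ~ edge i b,
      x = inG (sval x).1 * (inA i b * w), no_merge i w &
      alen x = (alen w).+1].
Proof.
case: x => -[g [|[[i b] q] l]] //= [Ab sb rq Hq Rl] _.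
pose w : amalgam := @amk (q, l) Rl.
have Rw : areduced i (sval w) by split.
exists i, b, w; split=> //; last exact: areduced_no_merge Rw.
  by split=> //; exact: reduced_not_edge.
apply: amalgam_eq => /=; rewrite nmul_nA // aact_cons //.
by rewrite /nmul /= /gact /= gmul1r.
Qed.

(** * Roots and normalizers in the amalgam *)

Hypothesis A_abelian : forall i a a', A i a -> A i a' -> gcommute a a'.
Hypothesis A_roots : forall i a a' n, A i a -> A i a' -> (0 < n)%N ->
  a ^+ n = a' ^+ n -> a = a'.
Hypothesis A_rank1 : forall i a a', A i a -> A i a' -> a' <> 1 ->
  commensurable a a'.
(** Malnormality of the edge groups, with conjugates of distinct ones meeting trivially; this is the
    source of acylindricity. *)
Hypothesis C_separated : forall i j c g, C i c -> c <> 1 -> C j (gconj g c) ->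
  i = j /\ C i g.
(** This makes elements of [G] conjugate into an abelian leaf, so that the nontrivial elliptic
    elements need only be studied in the [A i]. *)
Hypothesis C_cover : forall g, g <> 1 -> exists i c h, C i c /\ g = gconj h c.

Lemma inA_commute i a a' : A i a -> A i a' -> gcommute (inA i a) (inA i a').
Proof. by move=> Aa Aa'; rewrite /gcommute -!inAM // (A_abelian Aa). Qed.

Lemma inA_conj i a a' : A i a -> A i a' -> gconj (inA i a) (inA i a') = inA i a'.
Proof. by move=> Aa Aa'; apply/gconj_commute/inA_commute. Qed.

Lemma inA_conj_edge i a c : A i a -> C i c -> gconj (inA i a) (inG c) = inG c.
Proof. by move=> Aa Cc; rewrite -(inA_beta Cc) inA_conj //; exact: betaA. Qed.

(** An element fixing both ends of a geodesic fixes its first edge. Otherwise [w * z], of length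
    [alen w], would equal a product of length [alen w + 2]. *)
Lemma fixed_edge i b g z (x w : amalgam) : A i b -> ~ edge i b ->
    x = inG g * (inA i b * w) -> no_merge i w ->
    alen z = 0%N -> alen (gconj x z) = 0%N ->
  exists c, [/\ C i c, gconj w z = inG c & gconj x z = inG (gconj g c)].
Proof.
move=> Ab Eb xE nw z0 /alen0[v xz]; pose v1 := gconj g^-1 v.
have v1E : gconj (inA i b) (gconj w z) = inG v1.
  rewrite /v1 (hom_conj inGM) (homV inGM) -xz xE !gconjJ.
  by rewrite !gmulA gmulVl gmul1l.
have bV : A i b^-1 by exact: AV.
have Cv : C i v1.
  apply: contrapT => Cv.
  have e : w * z = inA i b^-1 * (inG v1 * (inA i b * w)).
    by rewrite -v1E inAV // /gconj !grpE.
  have EbV : ~ edge i b^-1.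
    by have [_ _ EV] := edge_subgrp i; move=> /EV; rewrite ginvK.
  have /(congr1 alen) := e; rewrite (alen_mulr _ z0) alen_grow //.
    by rewrite alen_mull // alen_grow //; lia.
  have [b' [bE Ab']] := aact_grow Ab Eb nw.
  move=> _; rewrite inGE inAE // bE /= => H; apply: Cv.
  by have := CM H (CV (kP Ab')); rewrite gmulK.
have wz : gconj w z = inG v1.
  by rewrite -(gconjK (inA i b) (gconj w z)) v1E -inAV // inA_conj_edge.
exists v1; split=> //; by rewrite /v1 !gconjJ gmulVr gconj1l.
Qed.

(** On a path of two syllables, [fixed_edge] gives conjugate elements of two edge groups. If
    nontrivial, [C_separated] puts the element between the syllables into the edge group, against
    reducedness. *)
Lemma alen_acylindrical (z w : amalgam) : alen z = 0%N ->
  alen (w^-1 * (z * w))%grp = 0%N -> (1 < alen w)%N -> z = 1.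
Proof.
rewrite -(ginvK w); move: w^-1 => {w} x; rewrite ginvK alenV => z0 xz0 Lx.
rewrite -/(gconj x z) in xz0.
have [i [b [w [fx [Ab Eb] xE nw lx]]]] := amalgam_front (ltnW Lx).
have [c [Cc wz _]] := fixed_edge Ab Eb xE nw z0 xz0.
have wz0 : alen (gconj w z) = 0%N by rewrite wz.
have [|j [b' [u [fw [Ab' Eb'] wE nu _]]]] := @amalgam_front w.
  by move: Lx; rewrite lx ltnS.
have [c' [Cc' _ wz']] := fixed_edge Ab' Eb' wE nu z0 wz0.
suff c1 : c = 1.
  by apply: (@gconj_eq1 _ w); rewrite wz c1 inG1.
apply: contrapT => c1; have cE : c = gconj (sval w).1 c'.
  by apply: inG_inj; rewrite -wz'.
have c'1 : c' <> 1 by move=> e; apply: c1; rewrite cE e gconj1.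
have [ji Cw] : j = i /\ C j (sval w).1.
  by apply: C_separated Cc' c'1 _; rewrite -cE.
by rewrite ji in fw Cw; exact: (nw fw).
Qed.

(** The four-point condition excludes cancellation across [x]. For [x] of length 0 it could occur,
    as [u] and [a] may merge. *)
Lemma alen_ends (u x a : amalgam) : (0 < alen x)%N ->
  (alen u <= 1)%N -> (alen a <= 1)%N ->
  alen (u * x)%grp = (alen x).+1 -> alen (x * a)%grp = (alen x).+1 ->
  ((alen x).+2 <= alen (u * x * a)%grp)%N.
Proof.
move=> Lx Lu La ux xa; have := alen4 1 (x * a) u^-1 x.
rewrite !(ldist1x alen) alenV xa.
have -> : ldist alen u^-1 x = alen (u * x)%grp by rewrite /ldist ginvK.
have -> : ldist alen (x * a) x = alen a by rewrite /ldist ginvM gmulVKr alenV.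
have -> : ldist alen (x * a) u^-1 = alen (u * x * a)%grp.
  by rewrite ldistC /ldist ?ginvK ?gmulA //; exact: alenV.
rewrite ux; lia.
Qed.

Lemma alen_inA_le i a : A i a -> (alen (inA i a) <= 1)%N.
Proof.
move=> Aa; have [Ea|Ea] := pselect (edge i a).
  by have [c _ ->] := edge_inA Ea.
rewrite -[inA i a]gmul1r alen_grow //.
Qed.


(** Letters of [A j] on the left and of [A i] on the right of [x] are removed by induction. For the
    remaining [x], the two sides of [x a = a' x] have different lengths unless [a] and [a'] both lie
    in edge groups or [x] lies in [G]. *)
Lemma vertex_malnormal i j a a' (x : amalgam) : A i a -> a <> 1 -> A j a' ->
  gconj x (inA i a) = inA j a' -> i = j /\ exists2 b, A i b & x = inA i b.
Proof.
have [n le_n] := ubnP (alen x).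
elim: n i j a a' x le_n => // n IHn i j a a' x; rewrite ltnS => le_n Aa a1 Aa' e.
have [Px|[b [y [Ab xE lx]]]] := amalgam_split j x; last first.
  have [|||||ij [b' Ab' yE]] := IHn i j a (gconj b^-1 a') y => //.
  - by rewrite lx in le_n.
  - by rewrite /gconj ginvK; apply: AM; [exact: AV|exact: AM].
  - have -> : gconj b^-1 a' = a'.
      by apply/gconj_commute/(A_abelian (AV Ab) Aa').
    by rewrite -(inA_conj (AV Ab) Aa') -e xE inAV // !gconjJ gmulVK.
  split=> //; subst j; exists (b * b'); first exact: AM.
  by rewrite inAM // -yE.
have [Qx|[b [y [Ab xE lx]]]] := amalgam_split i x^-1; last first.
  rewrite alenV in lx.
  have xE' : x = y^-1 * inA i b^-1 by rewrite -(ginvK x) xE ginvM inAV.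
  have [|||||ij [b' Ab' yE]] := IHn i j a a' y^-1 => //.
  - by rewrite alenV; rewrite lx in le_n.
  - by rewrite -e xE' -gconjJ inA_conj //; exact: AV.
  split=> //; exists (b' * b^-1); first exact/AM/AV.
  by rewrite xE' yE inAM //; exact: AV.
have Rx b : A i b -> ~ edge i b -> alen (x * inA i b)%grp = (alen x).+1.
  move=> Ab Eb; rewrite -alenV ginvM -inAV // Qx ?alenV //; first exact: AV.
  by have [_ _ EV] := edge_subgrp i; move=> /EV; rewrite ginvK.
have xa : x * inA i a = inA j a' * x by rewrite -e /gconj !grpE.
have G_case g : x = inG g -> C i g -> i = j -> 
    i = j /\ exists2 b, A i b & x = inA i b.
  move=> xg Cg ij; split=> //; exists (beta i g); first exact: betaA.
  by rewrite inA_beta.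
have [Ea|Ea] := pselect (edge i a); have [Ea'|Ea'] := pselect (edge j a').
- have [c Cc ac] := edge_inA Ea; have [c' Cc' ac'] := edge_inA Ea'.
  have c1 : c <> 1.
    by move=> c1; apply: a1; apply: (inA_inj Aa (A1 i)); rewrite ac c1 inG1 inA1.
  rewrite ac ac' in e.
  have [Lx|Lx] := ltnP 1 (alen x).
    case: c1; apply: inG_inj; rewrite inG1.
    apply: (@alen_acylindrical _ x^-1); rewrite ?alenV //.
    by rewrite ginvK -/(gconj x (inG c)) e.
  have [Lx0|Lx0] := posnP (alen x).
    have [g xg] := alen0 Lx0; move: (e); rewrite {1}xg -(hom_conj inGM) => /inG_inj ec.
    rewrite -ec in Cc'; have [ij Cg] := C_separated Cc c1 Cc'.
    exact: G_case xg Cg ij.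
  have [i1 [b [w [fx [Ab Eb] xE nw lx]]]] := amalgam_front Lx0.
  have w0 : alen w = 0%N by lia.
  have xc0 : alen (gconj x (inG c)) = 0%N by rewrite e.
  have [c1' [Cc1 wc _]] := fixed_edge Ab Eb xE nw (alen_inG c) xc0.
  have [q wq] := alen0 w0; move: wc; rewrite wq -(hom_conj inGM) => /inG_inj qc.
  rewrite -qc in Cc1; have [ii1 Cq] := C_separated Cc c1 Cc1; subst i1.
  (* With [q] in [C i], the element [x] ends in the [A i]-letter [b * beta i q]; removing it
     contradicts minimality on the right. *)
  have Abq : A i (b * beta i q)^-1 by apply/AV/AM => //; exact: betaA.
  have Ebq : ~ edge i (b * beta i q)^-1.
    have [_ _ EV] := edge_subgrp i; move=> /EV; rewrite ginvK => E.
    by apply: Eb; apply: edge_mulr E; exists q.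
  have := Rx _ Abq Ebq; rewrite xE wq -(inA_beta Cq) -(inAM Ab); last exact: betaA.
  by rewrite inAV ?gmulK //; apply: AM => //; exact: betaA.
- have [c Cc ac] := edge_inA Ea; move: xa => /(congr1 alen).
  rewrite Px // ac alen_mulr //; lia.
- have [c Cc ac] := edge_inA Ea'; move: xa => /(congr1 alen).
  rewrite Rx // ac alen_mull //; lia.
have Aa'V : A j a'^-1 by exact: AV.
have Ea'V : ~ edge j a'^-1.
  by have [_ _ EV] := edge_subgrp j; move=> /EV; rewrite ginvK.
have xE : inA j a'^-1 * x * inA i a = x by rewrite -gmulA xa inAV // gmulVK.
have [Lx0|Lx0] := posnP (alen x).
  have [g xg] := alen0 Lx0; have [|[ij Cg]] := no_merge_GA j g Aa Ea.
    rewrite -xg => H; have := alen_grow Aa'V Ea'V H.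
    by rewrite gmulA xE Rx //; lia.
  exact: G_case xg Cg ij.
have := alen_ends Lx0 (alen_inA_le Aa'V) (alen_inA_le Aa) (Px _ Aa'V Ea'V)
  (Rx _ Aa Ea).
by rewrite xE; lia.
Qed.

(** Cyclic reduction: after conjugation [x] is [b * v]. If [v] begins or ends with an [A i]-letter,
    this letter is absorbed into [b] and the length drops; otherwise [b * v] lies in a leaf or is
    cyclically reduced. *)
Lemma conj_vertex_or_hyperbolic (x : amalgam) : x <> 1 ->
  (exists h i a, A i a /\ x = gconj h (inA i a)) \/
  exists h, hyperbolic alen (gconj h x).
Proof.
have [n le_n] := ubnP (alen x).
elim: n x le_n => // n IHn x; rewrite ltnS => le_n x1.
have conj_case y h : (alen y < n)%N -> y = gconj h x ->
    (exists h i a, A i a /\ x = gconj h (inA i a)) \/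
    exists h, hyperbolic alen (gconj h x).
  move=> ly yE; have [||[h' [i [a [Aa e]]]]|[h' H]] := IHn y => //.
  - by move=> y1; apply: x1; apply: (@gconj_eq1 _ h); rewrite -yE.
  - left; exists (h^-1 * h'), i, a; split=> //.
    by rewrite -gconjJ -e yE gconjK.
  - by right; exists (h' * h); rewrite -gconjJ -yE.
have [Lx0|Lx0] := posnP (alen x).
  have [g xg] := alen0 Lx0; have [|i [c [h [Cc gE]]]] := C_cover (g := g).
    by move=> g1; apply: x1; rewrite xg g1 inG1.
  left; exists (inG h), i, (beta i c); split; first exact: betaA.
  by rewrite inA_beta // -(hom_conj inGM) -gE.
have [i [b [w [_ [Ab Eb] xE nw lx]]]] := amalgam_front Lx0.
set g := (sval x).1 in xE.
have xE1 : gconj (inG g)^-1 x = inA i b * (w * inG g) by rewrite xE /gconj !grpE.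
have lw' : alen (w * inG g)%grp = alen w by rewrite alen_mulr.
move: (w * inG g) xE1 lw' => v xE1 lv.
have [Pv|[a0 [y [Aa0 vE lvy]]]] := amalgam_split i v^-1; last first.
  rewrite alenV in lvy.
  apply: (conj_case (inA i (a0^-1 * b) * y^-1) ((inA i a0)^-1 * (inG g)^-1)).
    apply: leq_ltn_trans (alenM _ _) _.
    have := alen_inA_le (AM (AV Aa0) Ab); rewrite alenV; lia.
  rewrite -gconjJ xE1 inAM ?inAV //; last exact: AV.
  by rewrite -(ginvK v) vE /gconj !grpE.
have [Qv|[a1 [v1 [Aa1 vE lvv]]]] := amalgam_split i v; last first.
  apply: (conj_case (inA i (b * a1) * v1) (inG g)^-1).
    apply: leq_ltn_trans (alenM _ _) _.
    have := alen_inA_le (AM Ab Aa1); lia.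
  by rewrite xE1 vE inAM // gmulA.
have Rv : alen (v * inA i b)%grp = (alen v).+1.
  rewrite -alenV ginvM -inAV // Pv ?alenV //; first exact: AV.
  by have [_ _ EV] := edge_subgrp i; move=> /EV; rewrite ginvK.
have [Lv0|Lv0] := posnP (alen v).
  have [q vq] := alen0 Lv0; have [Cq|Cq] := pselect (C i q).
    left; exists (inG g), i, (b * beta i q); split; first exact/AM/betaA.
    rewrite inAM ?inA_beta -?vq -?xE1 ?gconjKV //; exact: betaA.
  right; exists (inG g)^-1; rewrite xE1; split; first by rewrite Qv.
  have Hn : no_merge i (v * inA i b).
    by rewrite vq; have [//|[_ /Cq]] := no_merge_GA i q Ab Eb.
  have -> : (inA i b * v) ^+ 2 = inA i b * (v * inA i b) * v.
    by rewrite gpowS gpow1 !gmulA.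
  by rewrite alen_mulr // alen_grow // Rv Qv // Lv0.
(* [b v b] has length at least [alen v + 2]; the four-point condition for 1, [b v b], [b v] and
   [b v b v] then doubles the length of [b v]. *)
right; exists (inG g)^-1; rewrite xE1; split; first by rewrite Qv.
have La := alen_inA_le Ab; have Lava := alen_ends Lv0 La La (Qv _ Ab Eb) Rv.
have := LM alen1 alenV alen4 (inA i b * v) (inA i b * v).
have := alen4 1 (inA i b * v * inA i b) (inA i b * v) (inA i b * v * (inA i b * v)).
rewrite !(ldist1x alen) gpowS gpow1.
have -> : ldist alen (inA i b * v) (inA i b * v * (inA i b * v)) = alen (inA i b * v)%grp.
  by rewrite /ldist gmulVK.
have -> : ldist alen (inA i b * v * inA i b) (inA i b * v * (inA i b * v)) = alen v.
  by rewrite /ldist (gmulA (inA i b * v)) gmulVK.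
have -> : ldist alen (inA i b * v * inA i b) (inA i b * v) = alen (inA i b).
  by rewrite ldistC /ldist ?gmulVK //; exact: alenV.
rewrite Qv //; lia.
Qed.


Lemma amalgam_torsion_free (x : amalgam) n : (0 < n)%N -> x ^+ n = 1 -> x = 1.
Proof.
move=> n0 xn; apply: contrapT => x1.
have [[h [i [a [Aa xE]]]]|[h hx]] := conj_vertex_or_hyperbolic x1.
  apply: x1; rewrite xE; suff -> : a = 1 by rewrite inA1 gconj1.
  apply: (A_roots Aa (A1 i) n0); rewrite gpow_one.
  apply: (inA_inj (AX n Aa) (A1 i)); rewrite inAX // inA1.
  by apply: (@gconj_eq1 _ h); rewrite gconjX -xE.
have := hyperbolicX alen1 alenV alen4 n hx.
by rewrite -gconjX xn gconj1 alen1; case: hx; lia.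
Qed.

(** A root commutes with its power, so [vertex_malnormal] puts the roots of an element of a leaf
    into that leaf. *)
Lemma amalgam_unique_roots : unique_roots amalgam.
Proof.
move=> x y n n0 e; have [z1|z1] := pselect (x ^+ n = 1).
  by rewrite (amalgam_torsion_free n0 z1) (@amalgam_torsion_free y n) // -e.
have [[h [i [a [Aa xE]]]]|[h]] := conj_vertex_or_hyperbolic z1; last first.
  rewrite gconjX => hx; apply: (@gconj_inj _ h).
  apply: (hyperbolic_root_unique alen1 alenV alen4 alen_acylindrical n0 hx).
  by rewrite -!gconjX e.
have a1 : a <> 1 by move=> a1; apply: z1; rewrite xE a1 inA1 gconj1.
have root w : w ^+ n = gconj h (inA i a) ->
    exists2 b, A i b & gconj h^-1 w = inA i b /\ b ^+ n = a.
  move=> wE; have aE : inA i a = gconj h^-1 w ^+ n by rewrite -gconjX wE gconjK.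
  have cw : gconj (gconj h^-1 w) (inA i a) = inA i a.
    by rewrite aE; apply/gconj_commute/gcommuteX.
  have [_ [b Ab wb]] := vertex_malnormal Aa a1 Aa cw; exists b => //; split=> //.
  apply: (inA_inj (AX n Ab) Aa); rewrite inAX // -wb -gconjX wE gconjK //.
have [b Ab [xb ba]] := root x xE; have [b' Ab' [yb ba']] := root y (etrans (esym e) xE).
have bb : b = b' by apply: (A_roots Ab Ab' n0); rewrite ba ba'.
by apply: (@gconj_inj _ h^-1); rewrite xb yb bb.
Qed.

Lemma amalgam_cyclic_normalizers : cyclic_normalizers amalgam.
Proof.
move=> x g k' l x1 k0 e.
have [[h [i [a [Aa xE]]]]|[h hx]] := conj_vertex_or_hyperbolic x1; last first.
  apply: (@commensurable_conj _ h).
  apply: (hyperbolic_normalizer alen1 alenV alen4 alen_acylindrical hx k0 (l := l)).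
  by rewrite -!gconjX -e !gconjJ {2}/gconj !grpE.
have a1 : a <> 1 by move=> a1; apply: x1; rewrite xE a1 inA1 gconj1.
have xa : gconj h^-1 x = inA i a by rewrite xE gconjK.
have ak1 : a ^+ k' <> 1.
  by move=> ak1; apply: a1; apply: (A_roots Aa (A1 i) k0); rewrite gpow_one.
have ge : gconj (gconj h^-1 g) (inA i (a ^+ k')) = inA i (a ^+ l).
  by rewrite !inAX // -xa -!gconjX -e !gconjJ {2}/gconj !grpE.
have [_ [b Ab gb]] := vertex_malnormal (AX k' Aa) ak1 (AX l Aa) ge.
have [m [n [m0 ba]]] := A_rank1 Ab Aa a1.
apply: (@commensurable_conj _ h^-1); rewrite gb xa; exists m, n; split=> //.
rewrite -!inAX // -inAV; last exact: AX.
by case: ba => ->; [left|right].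
Qed.

End Amalgam.

Theorem star_amalgam (G B : Grp) (I : Type) (C : I -> G -> Prop)
    (A : I -> B -> Prop) (beta : I -> G -> B) :
  (forall i, subgrp (C i)) -> (forall i, subgrp (A i)) ->
  (forall i c c', C i c -> C i c' -> beta i (c * c') = beta i c * beta i c') ->
  (forall i c, C i c -> A i (beta i c)) ->
  (forall i c c', C i c -> C i c' -> beta i c = beta i c' -> c = c') ->
  (forall i a a', A i a -> A i a' -> gcommute a a') ->
  (forall i a a' n, A i a -> A i a' -> (0 < n)%N -> a ^+ n = a' ^+ n -> a = a') ->
  (forall i a a', A i a -> A i a' -> a' <> 1 -> commensurable a a') ->
  (forall i j c g, C i c -> c <> 1 -> C j (gconj g c) -> i = j /\ C i g) ->
  (forall g, g <> 1 -> exists i c h, C i c /\ g = gconj h c) ->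
  exists (K : Grp) (jG : G -> K) (jA : I -> B -> K),
  [/\ unique_roots K /\ cyclic_normalizers K, is_hom jG,
      forall i a a', A i a -> A i a' -> jA i (a * a') = jA i a * jA i a',
      forall i c, C i c -> jA i (beta i c) = jG c &
      forall (W : Grp) (phi : G -> W) (psi : I -> B -> W), is_hom phi ->
        (forall i a a', A i a -> A i a' -> psi i (a * a') = psi i a * psi i a') ->
        (forall i c, C i c -> psi i (beta i c) = phi c) ->
        exists Phi : K -> W, [/\ is_hom Phi, forall g, Phi (jG g) = phi g &
          forall i a, A i a -> Phi (jA i a) = psi i a]].
Proof.
move=> Csub Asub betaM betaA beta_inj Aab Aroot Acyc Csep Ccov.
have /choice[r rP] : forall i, exists r : G -> G, [/\ r 1 = 1,
    forall g, C i (g * (r g)^-1) & forall c g, C i c -> r (c * g) = r g].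
  by move=> i; exact: transversal.
have /choice[s sP] : forall i, exists s : B -> B, [/\ s 1 = 1,
    forall b, edge C beta i (b * (s b)^-1) &
    forall d b, edge C beta i d -> s (d * b) = s b].
  by move=> i; apply: transversal; exact: edge_subgrp.
have /choice[k kP] : forall ib : I * B, exists c : G,
    C ib.1 c /\ ib.2 = beta ib.1 c * s ib.1 ib.2.
  move=> [i b]; have [_ + _] := sP i; move=> /(_ b)[c Cc e].
  by exists c; rewrite /= -e gmulVKr.
have r1 i : r i 1 = 1 by case: (rP i).
have rC1 i g : C i (g * (r i g)^-1) by case: (rP i).
have rC2 i c g : C i c -> r i (c * g) = r i g by case: (rP i) => _ _; apply.
have s1 i : s i 1 = 1 by case: (sP i).
have sC i c b : C i c -> s i (beta i c * b) = s i b.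
  by move=> Cc; case: (sP i) => _ _; apply; exists c.
have kP1 i b : A i b -> C i (k (i, b)) by have [] := kP (i, b).
have kP2 i b : A i b -> b = beta i (k (i, b)) * s i b by have [] := kP (i, b).
pose K := amalgam Csub Asub betaM betaA beta_inj r1 rC1 rC2 s1 sC kP1 kP2.
exists K, (inG _ _ _ _ _ _ _ _ _ _ _ _), (inA _ _ _ _ _ _ _ _ _ _ _ _); split.
- split.
    exact: amalgam_unique_roots.
  exact: amalgam_cyclic_normalizers.
- exact: inGM.
- by move=> i a a'; exact: inAM.
- by move=> i c; exact: inA_beta.
- by move=> W phi psi phiM psiM e; exact: amalgam_universal.
Qed.

(** * Products of commutators *)

Section CommutatorProducts.
Variable G : Grp.
Implicit Types x y z t : G.

Definition comm_prod n x := exists ps : seq (G * G),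
  size ps = n /\ x = gprod [seq gcomm p.1 p.2 | p <- ps].

Lemma comm_prod0 : comm_prod 0 1. Proof. by exists [::]. Qed.

Lemma comm_prodM m n x y : comm_prod m x -> comm_prod n y -> comm_prod (m + n) (x * y).
Proof.
move=> [ps [<- ->]] [qs [<- ->]]; exists (ps ++ qs).
by rewrite size_cat map_cat gprod_cat.
Qed.

Lemma comm_prodJ n t x : comm_prod n x -> comm_prod n (gconj t x).
Proof.
move=> [ps [<- ->]]; exists [seq (gconj t p.1, gconj t p.2) | p <- ps].
rewrite size_map -gprod_map_conj -!map_comp; split=> //; congr gprod.
by apply: eq_map => p /=; rewrite /gcomm !gconjM !gconjV.
Qed.

Lemma comm_prod_comm x y : comm_prod 1 (gcomm x y).
Proof. by exists [:: (x, y)]; rewrite /= gmul1r. Qed.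

Lemma comm_prodV n x : comm_prod n x -> comm_prod n x^-1.
Proof.
move=> [ps [<- ->]]; elim: ps => [|p ps IHps] /=; first by rewrite ginv1; exact: comm_prod0.
rewrite ginvM -addn1; apply: comm_prodM => //.
have -> : (gcomm p.1 p.2)^-1 = gcomm p.2 p.1 by rewrite /gcomm !grpE.
exact: comm_prod_comm.
Qed.

Lemma comm_prod_le m n x : (m <= n)%N -> comm_prod m x -> comm_prod n x.
Proof.
move=> le_mn Hx; rewrite -(subnK le_mn) -(gmul1l x); apply: comm_prodM => //.
exists (nseq (n - m) (1, 1)); rewrite size_nseq; split=> //.
by elim: (n - m)%N => //= k <-; rewrite /gcomm !grpE.
Qed.

(** Equality up to [n] commutators. Products of commutators are closed under conjugation, so errors
    add under multiplication. *)
Definition near n x y := comm_prod n (x * y^-1).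

Lemma near_refl x : near 0 x x.
Proof. by rewrite /near gmulVr; exact: comm_prod0. Qed.

Lemma near_trans m n x y z : near m x y -> near n y z -> near (m + n) x z.
Proof. by move=> H K; have := comm_prodM H K; rewrite gmulA gmulVKr. Qed.

Lemma nearM m n x y x' y' : near m x y -> near n x' y' ->
  near (m + n) (x * x') (y * y').
Proof.
move=> H K; rewrite addnC; have := comm_prodM (comm_prodJ x K) H.
by rewrite /near /gconj !grpE.
Qed.

Lemma near_swap x y : near 1 (x * y) (y * x).
Proof.
have := comm_prod_comm x^-1 y^-1; rewrite /near /gcomm.
by rewrite !grpE.
Qed.

Lemma near_mulX n x y : near n ((x * y) ^+ n) (x ^+ n * y ^+ n).
Proof.
elim: n => [|n IHn]; first by rewrite !gmul1l; exact: near_refl.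
rewrite !gpowS -addn1; apply: near_trans (nearM (near_refl _) IHn) _.
have := nearM (nearM (near_refl x) (near_swap y (x ^+ n))) (near_refl (y ^+ n)).
by rewrite !gmulA addn0.
Qed.

Lemma near_gprodX n (gs : seq G) :
  near (n * size gs) (gprod gs ^+ n) (gprod [seq g ^+ n | g <- gs]).
Proof.
elim: gs => [|g gs IHgs] /=; first by rewrite gpow_one muln0; exact: near_refl.
rewrite mulnS; apply: near_trans (near_mulX _ _ _) _.
exact: nearM (near_refl _) IHgs.
Qed.

Lemma comm_prod_cl_le gs n : comm_prod n (gprod gs) -> cl_le gs n.
Proof.
move=> [ps [sp e]]; exists (nseq (size gs) 1), ps; rewrite size_nseq -e.
split=> //; split=> //; congr gprod.
by elim: gs {e} => //= g gs ->; rewrite gconj1l.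
Qed.

(** * Quadratic words *)

Section QuadraticWords.
Variables (T : eqType) (v : T -> G).
Implicit Types (l : T * bool) (w : seq (T * bool)).

Definition flip l := (l.1, ~~ l.2).
Definition letter l := if l.2 then v l.1 else (v l.1)^-1.
(** Together with [uniq w]: each symbol occurs once with each sign or not at all, so [w] labels a
    polygon whose sides are glued to a closed orientable surface. *)
Definition flip_closed w := forall l, l \in w -> flip l \in w.
Definition word w := gprod (map letter w).

Lemma flipK : involutive flip.
Proof. by case=> t b; rewrite /flip /= negbK. Qed.

Lemma flip_neq l : flip l != l.
Proof. by case: l => t []; rewrite /flip /= xpair_eqE andbF. Qed.

Lemma letter_flip l : letter (flip l) = (letter l)^-1.
Proof. by case: l => t []; rewrite /letter //= ginvK. Qed.

Lemma word_cat w w' : word (w ++ w') = word w * word w'.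
Proof. by rewrite /word map_cat gprod_cat. Qed.

Lemma word_cons l w : word (l :: w) = letter l * word w.
Proof. by []. Qed.

(** Extraction of a handle in the classification of surfaces. *)
Lemma interlaced_comm (x y P Q R S : G) :
  near 1 (x * P * y * Q * x^-1 * R * y^-1 * S) (R * Q * P * S).
Proof.
have := comm_prodJ (R * Q) (comm_prod_comm ((R * Q)^-1 * x)^-1 (P * y * Q)^-1).
by rewrite /near /gcomm /gconj !grpE.
Qed.

(** Write the word as [l A l^-1 B]. If a letter of [A] has its inverse in [B], one commutator
    removes four letters; otherwise [A] and [B] are themselves quadratic. *)
Lemma quadratic_word w : uniq w -> flip_closed w ->
  exists2 n, (4 * n <= size w)%N & comm_prod n (word w).
Proof.
have [m le_m] := ubnP (size w); elim: m w le_m => // m IHm [|l w] /=.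
  by move=> _ _ _; exists 0%N => //; exact: comm_prod0.
rewrite ltnS => le_m /andP[lw uw] fc.
have : flip l \in w.
  by have := fc l (mem_head _ _); rewrite inE (negbTE (flip_neq l)).
move=> /path.splitPr wE; move: wE uw lw fc le_m => [A B].
rewrite cat_uniq /= mem_cat inE !negb_or => /and4P[uA /andP[nA AB] nB uB].
move=> /and3P[lA _ lB] fc le_m.
have fAB (k : T * bool) : k \in A ++ B -> flip k \in A ++ B.
  move=> kAB; have kl : k != l.
    by apply: contraTneq kAB => ->; rewrite mem_cat negb_or lA lB.
  have kl' : k != flip l.
    by apply: contraTneq kAB => ->; rewrite mem_cat negb_or nA nB.
  have := fc k; rewrite !(inE, mem_cat) in kAB *.
  have -> : (flip k == l) = false.
    by apply: contra_neqF kl' => /eqP <-; rewrite flipK.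
  have -> : (flip k == flip l) = false.
    by rewrite (inj_eq (can_inj flipK)); exact: negbTE.
  by move=> H; apply: H; case/orP: kAB => ->; rewrite ?orbT.
have uAB : uniq (A ++ B) by rewrite cat_uniq uA AB.
rewrite word_cons word_cat word_cons letter_flip.
have [/hasP[k kA kB]|no] := boolP (has (fun k => flip k \in B) A).
  move: kA => /path.splitPr AE; move: AE uAB lA fAB le_m {fc uA nA AB} => [A1 A2].
  move: kB => /path.splitPr BE; move: BE {uB nB lB} => [B1 B2].
  move=> uAB lA fAB le_m; pose N := B1 ++ A2 ++ A1 ++ B2.
  have pe : perm_eq ((A1 ++ k :: A2) ++ (B1 ++ flip k :: B2)) [:: k, flip k & N].
    by apply/seq.permP => p; rewrite /N !count_cat /= !count_cat; lia.
  have uN : uniq [:: k, flip k & N] by rewrite -(perm_uniq pe).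
  have cN : flip_closed N.
    move=> z zN; have : flip z \in [:: k, flip k & N].
      by rewrite -(perm_mem pe) fAB // (perm_mem pe) !inE zN !orbT.
    rewrite !inE (inj_eq (can_inj flipK)) => /or3P[/eqP zk|/eqP zk|//].
      by move: uN; rewrite /= -zk flipK zN andbF.
    by move: uN; rewrite /= -zk inE zN orbT.
  have [||n le_n Hn] := IHm N _ _ cN.
  - by move: le_m; rewrite /N !size_cat /= !size_cat /=; lia.
  - by case/and3P: uN.
  exists n.+1.
    by move: le_n; rewrite /N !size_cat /= !size_cat /=; lia.
  have := near_trans (interlaced_comm (letter l) (letter k) (word A1) (word A2)
    (word B1) (word B2)) (n := n) (z := 1).
  rewrite /near ginv1 !gmul1r !word_cat !word_cons letter_flip !gmulA add1n.
  by apply; move: Hn; rewrite /N !word_cat !gmulA.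
have cA : flip_closed A.
  move=> k kA; have := fAB k; rewrite !mem_cat kA => /(_ erefl)/orP[//|kB].
  by case/hasP: no; exists k.
have cB : flip_closed B.
  move=> k kB; have := fAB k; rewrite !mem_cat kB orbT => /(_ erefl)/orP[kA|//].
  by case/hasP: no; exists (flip k); rewrite ?flipK.
rewrite size_cat /= in le_m *.
have [|n1 le1 H1] := IHm A _ uA cA; first lia.
have [|n2 le2 H2] := IHm B _ uB cB; first lia.
exists (n1 + n2)%N; first lia.
have := comm_prodM (comm_prodJ (letter l) H1) H2.
by rewrite /gconj !gmulA.
Qed.

End QuadraticWords.
End CommutatorProducts.

(** * Wreath products and the transfer *)

Section Wreath.
Variables (G : Grp) (X : finType).

(* [(f, s)] acts on [X * G] by [(x, g) |-> (s x, f x * g)]. *)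
Definition wreath_car := ((X -> G) * {perm X})%type.
Definition wmul (a b : wreath_car) : wreath_car :=
  (fun x => a.1 (b.2 x) * b.1 x, (b.2 * a.2)%g).
Definition winv (a : wreath_car) : wreath_car :=
  (fun x => (a.1 ((a.2)^-1%g x))^-1, (a.2)^-1%g).

Definition wreath : Grp.
Proof.
apply: (@MkGroup wreath_car wmul (fun=> 1, 1%g) winv) => [a b c|[f s]|[f s]|[f s]|[f s]].
- rewrite /wmul /= mulgA; congr pair; apply: funext => x.
  by rewrite permM gmulA.
- by rewrite /wmul /= mulg1; congr pair; apply: funext => x; rewrite gmul1l.
- by rewrite /wmul /= mul1g; congr pair; apply: funext => x; rewrite perm1 gmul1r.
- by rewrite /wmul /= mulgV; congr pair; apply: funext => x; rewrite permK gmulVl.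
- by rewrite /wmul /= mulVg; congr pair; apply: funext => x; rewrite gmulVr.
Defined.

Definition wdiag (g : G) : wreath := (fun=> g, 1%g).

Lemma wdiagM : is_hom wdiag.
Proof.
by move=> g h; congr pair; rewrite /= mulg1.
Qed.

End Wreath.

Definition wmap (G H : Grp) (f : G -> H) (X : finType) (a : wreath G X) :
  wreath H X := (f \o a.1, a.2).

Lemma wmapM (G H : Grp) (f : G -> H) (X : finType) : is_hom f ->
  is_hom (@wmap G H f X).
Proof. by move=> fM a b; congr pair; apply: funext => x /=; rewrite fM. Qed.

Section Iterate.
Variables (G : Grp) (X Y : finType).

(** The imprimitive action, which flattens an iterated wreath product to a single one over
    [X * Y]. *)
Definition wcomp_fun (a : wreath (wreath G X) Y) (p : X * Y) : X * Y :=
  ((a.1 p.2).2 p.1, a.2 p.2).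

Lemma wcomp_inj a : injective (wcomp_fun a).
Proof.
by move=> [x y] [x' y'] [] /[swap] /perm_inj -> /perm_inj ->.
Qed.

Definition wcomp (a : wreath (wreath G X) Y) : wreath G (X * Y)%type :=
  (fun p => (a.1 p.2).1 p.1, perm (@wcomp_inj a)).

Lemma wcompM : is_hom wcomp.
Proof.
move=> a b; congr pair; first by apply: funext => -[x y]; rewrite /= permE.
by apply/permP => -[x y]; rewrite permM !permE /wcomp_fun /= !permM.
Qed.

Lemma wcomp_diag g : wcomp (wdiag Y (wdiag X g)) = wdiag _ g.
Proof.
congr pair; apply/permP => -[x y]; rewrite permE /wcomp_fun /= !perm1 //.
Qed.

End Iterate.

(** * Lifting equations from a wreath product to its base group *)

Section Transfer.
Variables (G : Grp) (X : finType) (T : eqType) (u : T -> wreath G X).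

Definition symbol := ((T * bool) + G)%type.
Implicit Types (s : seq symbol) (x y : X).

Definition wsym (e : symbol) : wreath G X :=
  match e with inl l => letter u l | inr g => wdiag X g end.
Definition wword s := gprod (map wsym s).

Definition vsym (e : (T * X) * bool + G) : G :=
  match e with
  | inl l => letter (fun p : T * X => (u p.1).1 p.2) l
  | inr g => g
  end.

(** An inverse letter read at [x] runs backwards along the edge that starts at the preimage of [x],
    in accordance with [winv]. *)
Definition at_point (e : symbol) x : (T * X) * bool + G :=
  match e with
  | inl (t, true) => inl ((t, x), true)
  | inl (t, false) => inl ((t, ((u t).2)^-1%g x), false)
  | inr g => inr g
  end.

Fixpoint lift s x : seq ((T * X) * bool + G) :=
  if s is e :: s' then at_point e ((wword s').2 x) :: lift s' x else [::].

Lemma vsym_at_point e x : vsym (at_point e x) = (wsym e).1 x.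
Proof. by case: e => [[t []]|g]. Qed.

Lemma lift_value s x : gprod (map vsym (lift s x)) = (wword s).1 x.
Proof. by elim: s => //= e s IHs; rewrite -/(gprod _) IHs vsym_at_point. Qed.

Definition letters (A B : Type) (s : seq (A + B)) : seq A :=
  pmap (fun e => if e is inl a then Some a else None) s.
Definition constants (A B : Type) (s : seq (A + B)) : seq B :=
  pmap (fun e => if e is inr b then Some b else None) s.

Lemma constants_lift s x : constants (lift s x) = constants s.
Proof. by elim: s => [|[[t []]|g] s IHs] //=; rewrite IHs. Qed.

Lemma size_letters_lift s x : size (letters (lift s x)) = size (letters s).
Proof. by elim: s => [|[[t []]|g] s IHs] //=; rewrite IHs. Qed.

Definition total_lift s := flatten [seq lift s x | x <- enum X].

Lemma total_lift_value s : gprod (map vsym (total_lift s)) =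
  gprod [seq (wword s).1 x | x <- enum X].
Proof.
rewrite /total_lift; elim: (enum X) => //= x xs IHxs.
by rewrite map_cat gprod_cat IHxs lift_value.
Qed.

Lemma mem_letters_lift s t b y : (t, b) \in letters s ->
  exists x, (t, y, b) \in letters (lift s x).
Proof.
elim: s => // e s IHs; have IH' : (t, b) \in letters s ->
    exists x, (t, y, b) \in letters (lift (e :: s) x).
  move=> /IHs[x Hx]; exists x.
  by case: e => [[t' []]|g] //=; rewrite inE Hx orbT.
case: e IH' => [[t' b']|g] IH' //=; rewrite inE => /orP[/eqP[-> ->]|/IH' //].
(* The lift starts at the point which the suffix [s] carries to [y], or to the image of [y] under
   [u t'] for an inverse letter. *)
case: b' {IH'}.
  by exists (((wword s).2)^-1%g y); rewrite /= permKV inE eqxx.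
by exists (((wword s).2)^-1%g ((u t').2 y)); rewrite /= permKV permK inE eqxx.
Qed.

Lemma letters_cat (A B : Type) (s s' : seq (A + B)) :
  letters (s ++ s') = letters s ++ letters s'.
Proof. by elim: s => [|[a|b] s IHs] //=; rewrite IHs. Qed.

Lemma constants_cat (A B : Type) (s s' : seq (A + B)) :
  constants (s ++ s') = constants s ++ constants s'.
Proof. by elim: s => [|[a|b] s IHs] //=; rewrite IHs. Qed.

Lemma mem_letters_total s t b y : (t, b) \in letters s ->
  (t, y, b) \in letters (total_lift s).
Proof.
move=> /(mem_letters_lift y)[x Hx]; rewrite /total_lift.
have : x \in enum X by rewrite mem_enum.
elim: (enum X) => // z xs IHxs; rewrite inE /= letters_cat mem_cat.
by case/orP => [/eqP <-|/IHxs ->]; rewrite ?Hx ?orbT.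
Qed.

Lemma size_letters_total s : size (letters (total_lift s)) = (#|X| * size (letters s))%N.
Proof.
rewrite /total_lift cardE; elim: (enum X) => //= x xs IHxs.
by rewrite letters_cat size_cat IHxs size_letters_lift mulSn.
Qed.

Lemma constants_total s : constants (total_lift s) =
  flatten (nseq #|X| (constants s)).
Proof.
rewrite /total_lift cardE; elim: (enum X) => //= x xs IHxs.
by rewrite constants_cat IHxs constants_lift.
Qed.

(** By counting: the lifts contain every [(t, y, b)], and their total number of letters leaves no
    room for repetitions. *)
Lemma letters_totalP s : uniq (letters s) -> flip_closed (letters s) ->
  uniq (letters (total_lift s)) /\ flip_closed (letters (total_lift s)).
Proof.
move=> us fs; pose P := [seq (l.1, y, l.2) | l <- letters s, y <- enum X].
have uP : uniq P.
  apply: allpairs_uniq => //; first exact: enum_uniq.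
  by move=> [[t b] y] [[t' b'] y'] _ _ /= [-> -> ->].
have sP : size (letters (total_lift s)) = size P.
  by rewrite size_letters_total size_allpairs -cardE mulnC.
have PS : {subset P <= letters (total_lift s)}.
  by move=> _ /allpairsP[[[t b] y] [/= ts _ ->]]; exact: mem_letters_total.
have [_ eP] := uniq_min_size uP PS (eq_leq sP).
split; first by apply: (leq_size_uniq uP PS); rewrite sP.
move=> l; rewrite -!eP => /allpairsP[[[t b] y] [/= ts _ ->]].
by apply/allpairsP; exists ((t, ~~ b), y); rewrite mem_enum (fs (t, b)).
Qed.

Lemma near_constants (s : seq ((T * X) * bool + G)) :
  near (size (constants s)) (gprod (map vsym s))
    (word (fun p : T * X => (u p.1).1 p.2) (letters s) * gprod (constants s)).
Proof.
elim: s => [|[l|g] s IHs] /=; first by rewrite gmul1l; exact: near_refl.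
  by rewrite -gmulA -[size _]add0n; exact: nearM (near_refl _) IHs.
rewrite -addn1; apply: near_trans (nearM (near_refl _) IHs) _.
by rewrite !gmulA -[1%N]addn0; exact: nearM (near_swap _ _) (near_refl _).
Qed.

(** One multiple of [#|X| * size (constants s)] pays for moving the constants to the right of the
    letters, the other for replacing the power of their product by the product of their powers. *)
Lemma transfer_word s : uniq (letters s) -> flip_closed (letters s) ->
  wword s = 1 -> exists2 n, (4 * n <= #|X| * size (letters s))%N &
    comm_prod (n + 2 * (#|X| * size (constants s)))
      (gprod [seq g ^+ #|X| | g <- constants s]).
Proof.
move=> us fs ws; have [uL fL] := letters_totalP us fs.
have [n le_n Hn] := quadratic_word (fun p : T * X => (u p.1).1 p.2) uL fL.
rewrite size_letters_total in le_n; exists n => //.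
have v1 : gprod (map vsym (total_lift s)) = 1.
  rewrite total_lift_value ws /=; elim: (enum X) => //= x xs ->.
  exact: gmul1l.
have sc : size (constants (total_lift s)) = (#|X| * size (constants s))%N.
  by rewrite constants_total size_flatten /shape map_nseq sumn_nseq mulnC.
have cE : gprod (constants (total_lift s)) = gprod (constants s) ^+ #|X|.
  by rewrite constants_total; elim: #|X| => //= k <-; rewrite gprod_cat.
have := near_constants (total_lift s); rewrite v1 sc cE.
move: (word _ _) Hn => Q HQ Hc.
have H1 : near n (Q * gprod (constants s) ^+ #|X|) (gprod (constants s) ^+ #|X|).
  by rewrite /near gmulK.
have := near_trans (near_trans Hc H1) (near_gprodX _ _).
rewrite /near gmul1l => /comm_prodV; rewrite ginvK.
by apply: comm_prod_le; lia.
Qed.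

End Transfer.

(** For r = [size gs], the word has 2 r + 4 k letters, whose lifts cost at most [#|X|] (r/2 + k)
    commutators; the constants cost 2 r [#|X|] more, and r/2 + 2 r is rounded up to 3 r. *)
Theorem transfer_cl_le (G : Grp) (X : finType) (gs : seq G) k :
  cl_le (map (wdiag X) gs) k ->
  cl_le [seq g ^+ #|X| | g <- gs] (#|X| * (k + 3 * size gs)).
Proof.
move=> [ts [ps [st [sp e]]]]; rewrite size_map in st.
have [qs [sq eq]] : comm_prod k (gprod [seq gcomm p.1 p.2 | p <- ps])^-1.
  by apply: comm_prodV; exists ps.
pose W := wreath G X.
(* Kind 0 names the conjugators; kinds 1 and 2 name the two entries of the commutators. These are
   taken from [qs], so that the equation becomes a word equal to 1. *)
pose u (t : (nat * nat)%type) : W :=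
  match t with
  | (0%N, j) => nth 1 ts j
  | (1%N, j) => (nth (1, 1) qs j).1
  | (_, j) => (nth (1, 1) qs j).2
  end.
pose conj_word j : seq (symbol G (nat * nat)%type) :=
  [:: inl ((0%N, j), true); inr (nth 1 gs j); inl ((0%N, j), false)].
pose comm_word j : seq (symbol G (nat * nat)%type) :=
  [:: inl ((1%N, j), false); inl ((2%N, j), false); inl ((1%N, j), true);
      inl ((2%N, j), true)].
pose s := flatten (map conj_word (iota 0 (size gs))) ++
          flatten (map comm_word (iota 0 k)).
have ls : letters s =
    [seq ((0%N, j), b) | j <- iota 0 (size gs), b <- [:: true; false]] ++
    [seq ((c.1, j), c.2) | j <- iota 0 k,
       c <- [:: (1%N, false); (2%N, false); (1%N, true); (2%N, true)]].
  rewrite /s letters_cat; congr cat.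
    by elim: (iota 0 (size gs)) => //= j js ->.
  by elim: (iota 0 k) => //= j js ->.
have cs : constants s = gs.
  rewrite /s constants_cat -[RHS]cats0; congr cat.
    rewrite -[RHS](mkseq_nth 1) /mkseq.
    by elim: (iota 0 (size gs)) => //= j js ->.
  by elim: (iota 0 k) => //= j js ->.
have us : uniq (letters s).
  rewrite ls cat_uniq; apply/and3P; split.
  - apply: allpairs_uniq; rewrite ?iota_uniq //.
    by move=> [j b] [j' b'] _ _ /= [-> ->].
  - apply/hasPn => _ /allpairsP[[j [c b]] [/= _ cb ->]].
    apply/negP => /flatten_mapP[j' _]; rewrite !inE => /orP[] /eqP[c0 _ _];
    by move: cb; rewrite c0.
  - apply: allpairs_uniq; rewrite ?iota_uniq //.
    by move=> [j [c b]] [j' [c' b']] _ _ /= [-> -> ->].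
have fs : flip_closed (letters s).
  move=> l; rewrite ls !mem_cat => /orP[] /allpairsP[[j c] [jI cI ->]]; apply/orP.
    left; apply/allpairsP; exists (j, ~~ c); split=> //=.
    by case: (c).
  right; apply/allpairsP; exists (j, (c.1, ~~ c.2)); split=> //=.
  by move: cI; rewrite /= !inE => /or4P[] /eqP ->.
have gf (ss : seq (seq (symbol G (nat * nat)%type))) :
    gprod (map (wsym u) (flatten ss)) =
    gprod [seq gprod (map (wsym u) w) | w <- ss].
  by elim: ss => //= w ss IHss; rewrite map_cat gprod_cat IHss.
have ws : wword u s = 1.
  rewrite /wword /s map_cat gprod_cat.
  have -> : gprod (map (wsym u) (flatten (map conj_word (iota 0 (size gs))))) =
      gprod [seq gconj tg.1 tg.2 | tg <- zip ts (map (wdiag X) gs)].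
    rewrite gf -map_comp -(mkseq_nth (1, 1) (zip _ _)) size_zip size_map st minnn.
    rewrite /mkseq -map_comp; congr gprod; apply/eq_in_map => i; rewrite mem_iota => lt_i.
    rewrite /comp nth_zip ?size_map // (nth_map 1) //.
    by congr gmul; congr gmul; exact: gmul1r.
  have -> : gprod (map (wsym u) (flatten (map comm_word (iota 0 k)))) =
      gprod [seq gcomm p.1 p.2 | p <- qs].
    rewrite gf -map_comp -[in RHS](mkseq_nth (1, 1) qs) sq /mkseq -map_comp.
    congr gprod; apply: eq_map => i.
    by rewrite /comp [RHS]/gcomm -gmulA; do 3!congr gmul; exact: gmul1r.
  by rewrite e -eq gmulVr.
have [n le_n Hn] := transfer_word us fs ws; rewrite cs in Hn.
apply: comm_prod_cl_le; apply: comm_prod_le Hn.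
move: le_n; rewrite ls size_cat !size_allpairs !size_iota /=; nia.
Qed.

(** * Adjoining roots *)

Lemma commensurableP (G : Grp) (g x : G) :
  commensurable g x <-> exists m z, (0 < m)%N /\ g ^+ m = gpowz x z.
Proof.
split=> [[m [n [m0 [e|e]]]]|[m [[n|n] [m0 e]]]].
- by exists m, (Posz n).
- by exists m, (- Posz n)%R; rewrite gpowzN.
- by exists m, n; split=> //; left.
- by exists m, n.+1; split=> //; right.
Qed.

Lemma subgrpXz (G : Grp) (P : G -> Prop) x z : subgrp P -> P x -> P (gpowz x z).
Proof.
move=> [P1 PM PV] Px; have PX n : P (x ^+ n).
  by elim: n => //= n IHn; exact: PM.
by case: z => n; [exact: PX|apply: PV; exact: PX].
Qed.

(** * Isolators in groups with unique roots *)

Section UniqueRoots.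
Variable G : Grp.
Hypothesis UR : unique_roots G.
Implicit Types x y g w : G.

Lemma torsion_free x n : (0 < n)%N -> x ^+ n = 1 -> x = 1.
Proof. by move=> n0 e; apply: (UR n0); rewrite gpow_one. Qed.

Lemma gcommute_root x y n : (0 < n)%N -> gcommute y (x ^+ n) -> gcommute y x.
Proof.
by move=> n0 /gconj_commute e; apply/gconj_commute/(UR n0); rewrite -gconjX.
Qed.

Definition isolator w x := commensurable x w.

Lemma isolator_commute w x y : isolator w x -> isolator w y -> gcommute x y.
Proof.
move=> /commensurableP[m [z [m0 e]]] /commensurableP[n [t [n0 f]]].
have xw : gcommute w x.
  by apply: (gcommute_root m0); rewrite e; exact: gcommutez.
by apply: (gcommute_root n0); rewrite f; apply/gcommutez/gcommute_sym.
Qed.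

Lemma isolator_subgrp w : subgrp (isolator w).
Proof.
split=> [|x y Hx Hy|x]; rewrite /isolator.
- by exists 1%N, 0%N; split=> //; left; rewrite gpow_one.
- have xy := isolator_commute Hx Hy.
  move: Hx Hy => /commensurableP[m [z [m0 e]]] /commensurableP[n [t [n0 f]]].
  apply/commensurableP; exists (m * n)%N, (z * n + t * m)%R.
  split; first by rewrite muln_gt0 m0.
  by rewrite gpowMc // gpowM e mulnC gpowM f gpowzD !gpowzMn.
- move=> /commensurableP[m [z [m0 e]]]; apply/commensurableP.
  by exists m, (- z)%R; rewrite gpowV gpowzN e.
Qed.

Lemma isolator_rank1 w x y : isolator w x -> isolator w y -> y <> 1 ->
  commensurable x y.
Proof.
move=> /commensurableP[m [z [m0 e]]] /commensurableP[n [t [n0 f]]] y1.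
apply/commensurableP; have t0 : t <> 0%R.
  by move=> t0; apply: y1; apply: (torsion_free n0); rewrite f t0.
exists (m * `|t|)%N, (Posz n * (z * sgz t))%R; split.
  by rewrite muln_gt0 m0 absz_gt0; apply/eqP.
rewrite gpowM e gpowzM gpowz_nat f -gpowzMn -gpowzM; congr gpowz.
by rewrite abszEsg; ring.
Qed.

Lemma commensurable_trans x y z : commensurable x y -> commensurable y z ->
  commensurable x z.
Proof.
move=> /commensurableP[m [a [m0 e]]] /commensurableP[n [b [n0 f]]].
apply/commensurableP; exists (m * n)%N, (b * a)%R; split.
  by rewrite muln_gt0 m0.
by rewrite gpowM e -gpowzMn (mulrC a) !gpowzM gpowz_nat f.
Qed.

Lemma commensurable_sym x y : x <> 1 -> commensurable x y -> commensurable y x.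
Proof.
move=> x1 H; apply: (@isolator_rank1 y) => //.
by exists 1%N, 1%N; split=> //; left.
Qed.

Lemma commensurable_conjE t x y :
  commensurable x y -> commensurable (gconj t x) (gconj t y).
Proof. by apply: commensurable_hom; exact: gconjM. Qed.

(** The identity forms its own class: being commensurable with every element, it would destroy
    transitivity. *)
Definition conj_commensurable x y :=
  (x = 1 /\ y = 1) \/ [/\ x <> 1, y <> 1 & exists t, commensurable (gconj t x) y].

Lemma isolator_representatives : exists I : G -> Prop,
  [/\ forall i, I i -> i <> 1,
      forall g, g <> 1 -> exists i t, I i /\ isolator i (gconj t g) &
      forall i j t, I i -> I j -> commensurable (gconj t i) j -> i = j].
Proof.
have [x|x y|x y z|rep [repP repE]] := @class_representatives G conj_commensurable.
- have [->|x1] := pselect (x = 1); [by left|right; split=> //].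
  by exists 1, 1%N, 1%N; split=> //; left; rewrite gconj1l.
- case=> [[-> ->]|[x1 y1 [t H]]]; [by left|right; split=> //].
  exists t^-1; apply: (@commensurable_conj _ t); rewrite gconjKV.
  apply: commensurable_sym H => xt; exact: x1 (gconj_eq1 xt).
- case=> [[-> ->]|[x1 y1 [t H]]] // [[y1']|[_ z1 [s K]]]; first by case: y1.
  right; split=> //; exists (s * t); rewrite -gconjJ.
  exact: commensurable_trans (commensurable_conjE s H) K.
exists (fun x => x <> 1 /\ rep x = x); split=> [i []//|g g1|i j t [i1 ri] [j1 rj] H].
  have [[/g1//]|[_ r1 [t H]]] := repP g.
  by exists (rep g), t; split=> //; split=> //; apply/esym/repE.
by rewrite -ri -rj; apply: repE; right; split=> //; exists t.
Qed.

End UniqueRoots.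

(** * The representation induced from an isolator to its p-th root extension *)

Section InducedRepresentation.
Variables (G : Grp) (C : G -> Prop) (p : nat).
Hypothesis UR : unique_roots G.
Hypothesis C_subgrp : subgrp C.
Hypothesis C_abelian : forall a b, C a -> C b -> gcommute a b.
Hypothesis C_rank1 : forall a b, C a -> C b -> b <> 1 -> commensurable a b.
Hypothesis p_prime : prime p.

Let C1 : C 1. Proof. by case: C_subgrp. Qed.
Let CM a b : C a -> C b -> C (a * b).
Proof. by case: C_subgrp => _ H _; apply: H. Qed.
Let CV a : C a -> C a^-1.
Proof. by case: C_subgrp => _ _ H; apply: H. Qed.
Let CX z a : C a -> C (gpowz a z). Proof. exact: subgrpXz. Qed.
Let p_gt0 : (0 < p)%N. Proof. exact: prime_gt0. Qed.

Definition has_root a := exists2 d, C d & a = d ^+ p.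

Lemma bezout_prime z : ~~ (p %| `|z|)%N -> exists a b : int, (a * z + b * p = 1)%R.
Proof.
rewrite -prime_coprime // coprime_sym => cz.
have /coprimezP[[a b] /= e] : coprimez z p by rewrite /coprimez /gcdz absz_nat (eqP cz).
by exists a, b.
Qed.

Lemma root_of_power u d z : C u -> C d -> ~~ (p %| `|z|)%N ->
  gpowz u z = d ^+ p -> has_root u.
Proof.
move=> Cu Cd /bezout_prime[a [b e]] ud.
exists (gpowz d a * gpowz u b); first by apply: CM; exact: CX.
rewrite gpowMc; last by apply: C_abelian; exact: CX.
have -> : gpowz d a ^+ p = gpowz u (a * z)%R.
  by rewrite -gpowzMn (mulrC a) (gpowzM d) gpowz_nat -ud -gpowzM mulrC.
by rewrite -gpowzMn -gpowzD e gpowz_nat gpow1.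
Qed.

(** By rank 1, [C/C^p] is generated by the class of [u]. From a relation [b ^+ m = gpowz u z] common
    factors [p] are cancelled. If then [p] does not divide [m], Bezout solves for [b]; otherwise [u]
    would be a p-th power. *)
Lemma coset_decomposition u b : C u -> ~ has_root u -> C b ->
  exists (k : 'I_p) d, C d /\ b = u ^+ k * d ^+ p.
Proof.
move=> Cu nu Cb.
have u1 : u <> 1 by move=> u1; apply: nu; exists 1; rewrite ?gpow_one.
have /commensurableP[m [z [m0 e]]] := C_rank1 Cb Cu u1.
have [M le_M] := ubnP m; elim: M m z m0 e le_M => // M IHM m z m0 e.
rewrite ltnS => le_M.
have [pm|pm] := boolP (p %| `|Posz m|)%N; last first.
  have [s [t st]] := bezout_prime pm.
  have p0 : (p%:Z != 0)%R by rewrite eqz_nat -lt0n.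
  have kp : (`|(z * s %% p)%Z| < p)%N.
    by have := modz_ge0 (z * s)%R p0; have := ltz_pmod (z * s)%R (d := p); lia.
  exists (Ordinal kp), (gpowz u (z * s %/ p)%Z * gpowz b t).
  split; first by apply: CM; exact: CX.
  rewrite gpowMc; last by apply: C_abelian; exact: CX.
  have bE : b = gpowz u (z * s)%R * gpowz b t ^+ p.
    rewrite gpowzM -e -[b ^+ m]gpowz_nat -gpowzM (mulrC (Posz m)) -gpowzMn.
    by rewrite -gpowzD st gpowz_nat gpow1.
  rewrite {1}bE gmulA; congr (_ * _).
  have kE : Posz (Ordinal kp) = (z * s %% p)%Z by rewrite /= gez0_abs ?modz_ge0.
  by rewrite -gpowzMn -[u ^+ _]gpowz_nat kE -gpowzD addrC -divz_eq.
have [pz|pz] := boolP (p %| `|z|)%N.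
  move: pm => /dvdnP[m' mE]; have /dvdzP[z' zE] : (p %| z)%Z by [].
  rewrite absz_nat in mE; subst m z.
  have m'0 : (0 < m')%N by move: m0; rewrite muln_gt0 => /andP[].
  apply: (IHM m' z') => //.
    by apply: (UR p_gt0); rewrite -gpowM e gpowzMn.
  by have := prime_gt1 p_prime; nia.
case: nu; move: pm => /dvdnP[m' mE]; apply: (@root_of_power u (b ^+ m') z) => //.
  exact: (CX (Posz m') Cb).
by rewrite -e -gpowM -mE.
Qed.

Lemma coset_unique u k k' d d' : C u -> ~ has_root u -> C d -> C d' ->
  (k < p)%N -> (k' < p)%N -> u ^+ k * d ^+ p = u ^+ k' * d' ^+ p ->
  k = k' /\ d = d'.
Proof.
move=> Cu nu Cd Cd' kp k'p e.
have wlog_lt a b c c' : C c -> C c' -> (a < b < p)%N ->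
    u ^+ a * c ^+ p = u ^+ b * c' ^+ p -> False.
  move=> Cc Cc' /andP[ab bp] {}e; apply: nu.
  apply: (@root_of_power u (c * c'^-1) (b - a)%N) => //.
  - exact/CM/CV.
  - by rewrite gtnNdvd //= ?subn_gt0 // (leq_ltn_trans (leq_subr _ _) bp).
  - rewrite gpowMc; last exact/C_abelian/CV.
    move: e; rewrite -{1}(subnK (ltnW ab)) addnC gpowD -gmulA => /gmulI ->.
    by rewrite gpowV gmulK.
have [lt|lt|kk] := ltngtP k k'.
- by case: (wlog_lt k k' d d') => //; rewrite lt.
- by case: (wlog_lt k' k d' d) => //; rewrite lt.
- by split=> //; apply: (UR p_gt0); rewrite kk in e; exact: gmulI e.
Qed.

(* The representation of [C^(1/p)], identified with [C] via p-th powers, induced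
   from the inclusion of [C] in [G]. *)
Lemma induced_representation : exists psi : G -> wreath G 'I_p,
  (forall a b, C a -> C b -> psi (a * b) = psi a * psi b) /\
  (forall c, C c -> psi (c ^+ p) = wdiag 'I_p c).
Proof.
have [[u Cu nu]|H] := pselect (exists2 u, C u & ~ has_root u); last first.
  (* Here every element of [C] is a p-th power in [C], and the representation is the diagonal one
     composed with the p-th root. *)
  have /choice[f fP] : forall a, exists d, C a -> C d /\ a = d ^+ p.
    move=> a; have [Ca|] := pselect (C a); last by exists 1.
    have [[d Cd e]|na] := pselect (has_root a); first by exists d.
    by case: H; exists a.
  exists (fun a => wdiag _ (f a)); split=> [a b Ca Cb|c Cc].
    rewrite -wdiagM; congr wdiag; apply: (UR p_gt0).
    have [Ca' ea] := fP a Ca; have [Cb' eb] := fP b Cb.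
    have [_ <-] := fP (a * b) (CM Ca Cb).
    by rewrite gpowMc -?ea -?eb //; exact: C_abelian.
  congr wdiag; apply: (UR p_gt0).
  by have [|_ <-] := fP (c ^+ p) => //; exact: (CX (Posz p) Cc).
(* The powers [u ^+ i] represent the cosets of [C^p]; multiplication by [a] permutes them, and the
   p-th roots of the correction factors form the cocycle. *)
have /choice[f fP] : forall a, exists x : wreath G 'I_p, C a -> forall i : 'I_p,
    C (x.1 i) /\ a * u ^+ i = u ^+ (x.2 i) * (x.1 i) ^+ p.
  move=> a; have [Ca|] := pselect (C a); last by exists 1.
  have /choice[k kP] : forall i : 'I_p, exists k : 'I_p, exists d,
      C d /\ a * u ^+ i = u ^+ k * d ^+ p.
    by move=> i; apply: coset_decomposition => //; exact/CM/(CX (Posz i) Cu).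
  have /choice[d dP] := kP.
  have k_inj : injective k.
    move=> i j kij; have [Ci ei] := dP i; have [Cj ej] := dP j.
    apply: val_inj; have [] // := @coset_unique u i j (d j) (d i) Cu nu Cj Ci.
    apply: (@gmulI _ a); rewrite !gmulA ei ej kij -!gmulA; congr (_ * _).
    by rewrite -!gpowMc; [rewrite (C_abelian Ci Cj)|exact: C_abelian..].
  by exists (d, perm k_inj) => _ i; rewrite permE.
exists f; split=> [a b Ca Cb|c Cc].
  have fa := fP a Ca; have fb := fP b Cb; have fab := fP _ (CM Ca Cb).
  have H i : ((f (a * b)).2 i = (f a).2 ((f b).2 i) /\
      (f (a * b)).1 i = (f a).1 ((f b).2 i) * (f b).1 i).
    have [Cab eab] := fab i; have [Cb' eb] := fb i.
    have [Ca' ea] := fa ((f b).2 i).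
    have [|H1 H2] := @coset_unique u _ _ _ _ Cu nu Cab (CM Ca' Cb')
      (ltn_ord ((f (a * b)).2 i)) (ltn_ord ((f a).2 ((f b).2 i))).
    - rewrite -eab gpowMc; last exact: C_abelian.
      by rewrite [RHS]gmulA -ea -[RHS]gmulA -eb gmulA.
    by split=> //; exact: val_inj.
  rewrite [f (a * b)]surjective_pairing; congr pair.
    by apply: funext => i; rewrite (H i).2.
  by apply/permP => i; rewrite permM (H i).1.
have fc := fP _ (CX (Posz p) Cc).
have H (i : 'I_p) : ((f (c ^+ p)).2 i = i /\ (f (c ^+ p)).1 i = c).
  have [Cd ed] := fc i.
  have [|H1 H2] := @coset_unique u _ _ _ _ Cu nu Cd Cc
    (ltn_ord ((f (c ^+ p)).2 i)) (ltn_ord i).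
    by rewrite -ed; apply: C_abelian; [exact: (CX (Posz p))|exact: (CX (Posz i))].
  by split=> //; exact: val_inj.
rewrite [f _]surjective_pairing; congr pair.
  by apply: funext => i; rewrite (H i).2.
by apply/permP => i; rewrite perm1 (H i).1.
Qed.

End InducedRepresentation.

Definition root_group (G : Grp) := unique_roots G /\ cyclic_normalizers G.

Lemma isolator_separated (G : Grp) (i j c g : G) : root_group G ->
  i <> 1 -> isolator i c -> c <> 1 -> isolator i (gconj g c) -> isolator i g.
Proof.
move=> [UR CN] i1 /commensurableP[m [z [m0 e]]] c1.
move=> /commensurableP[n [t [n0 f]]].
have z0 : z <> 0%R by move=> z0; apply: c1; apply: (torsion_free UR m0); rewrite e z0.
pose k := (z * n)%R; pose l := (t * m)%R.
have kl : gconj g (gpowz i k) = gpowz i l.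
  have -> : gpowz i k = c ^+ (m * n)%N by rewrite /k gpowzMn -e gpowM.
  have -> : gpowz i l = gconj g c ^+ (n * m)%N by rewrite /l gpowzMn -f gpowM.
  by rewrite gconjX mulnC.
have k0 : (0 < `|k| * `|k|)%N.
  have : k <> 0%R by rewrite /k; nia.
  by case: (k) => [[|?]|?].
have kkE (h : int) x : x ^+ (`|h| * `|h|)%N = gpowz x (h * h)%R :> G.
  by rewrite -gpowz_nat; congr gpowz; rewrite PoszM; lia.
(* [cyclic_normalizers] takes natural exponents, while [k] and [l] are signed: conjugating twice
   sends the power of [i] with exponent [k * k] to that with exponent [l * l]. *)
have [a [b [a0 H]]] : commensurable (g * g) i.
  apply: (CN i _ _ (`|l| * `|l|)%N i1 k0).
  rewrite !kkE -gconjJ (gpowzM i k k) gconjXz kl -gpowzM (mulrC l) (gpowzM i k l).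
  by rewrite gconjXz kl -gpowzM.
exists (2 * a)%N, b; split; first by rewrite muln_gt0.
by rewrite gpowM /= gmul1r.
Qed.

(* The vertex groups are the isolators [C i] themselves, the edge groups being
   embedded in them by the p-th power map. *)
Theorem root_extension (G : Grp) (p : nat) : root_group G -> prime p ->
  exists (K : Grp) (e : G -> K) (theta : K -> wreath G 'I_p),
  [/\ root_group K, is_hom e, is_hom theta,
      forall g, theta (e g) = wdiag 'I_p g & forall g, exists u, u ^+ p = e g].
Proof.
move=> rG pp; have [UR CN] := rG; have p0 := prime_gt0 pp.
have [I [I1 Icov Isep]] := isolator_representatives UR.
pose C (i : {i | I i}) : G -> Prop := isolator (sval i).
have Csub i : subgrp (C i) by exact: isolator_subgrp.
have Cab i a b : C i a -> C i b -> gcommute a b by exact: isolator_commute.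
have Crk i a b : C i a -> C i b -> b <> 1 -> commensurable a b.
  exact: isolator_rank1.
have Csep i j c g : C i c -> c <> 1 -> C j (gconj g c) -> i = j /\ C i g.
  move=> Ci c1 Cj; have ij : i = j.
    case: i j Ci Cj => [i Hi] [j Hj] Ci Cj; apply: eq_exist => /=.
    apply: (Isep i j g) => //; apply: commensurable_trans Cj.
    exact/commensurable_conjE/commensurable_sym.
  split=> //; subst j; apply: isolator_separated Ci c1 Cj => //.
  exact: I1 (svalP i).
have Ccov g : g <> 1 -> exists i c h, C i c /\ g = gconj h c.
  move=> /Icov[i [t [Hi Hg]]]; exists (exist _ i Hi), (gconj t g), t^-1.
  by split=> //; rewrite gconjK.
have [||||K [e [jA [rK eM jAM jAe univ]]]] := @star_amalgam G G _ C C
  (fun _ c => c ^+ p) Csub Csub _ _ _ Cab _ Crk Csep Ccov.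
- by move=> i c c' Cc Cc'; apply: gpowMc; exact: Cab Cc Cc'.
- by move=> i c Cc; exact: (subgrpXz (Posz p) (Csub i) Cc).
- by move=> i c c' _ _; exact: UR.
- by move=> i a a' n _ _; exact: UR.
have /choice[psi psiP] i : exists psi : G -> wreath G 'I_p,
    (forall a b, C i a -> C i b -> psi (a * b) = psi a * psi b) /\
    (forall c, C i c -> psi (c ^+ p) = wdiag 'I_p c).
  by apply: induced_representation => //; [exact: Cab|exact: Crk].
have [|||theta [tM te tA]] := univ _ (wdiag 'I_p) psi.
- exact: wdiagM.
- by move=> i; have [] := psiP i.
- by move=> i; have [] := psiP i.
exists K, e, theta; split=> // g.
have [->|/Ccov[i [c [h [Cc ->]]]]] := pselect (g = 1).
  by exists 1; rewrite gpow_one (hom1 eM).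
exists (gconj (e h) (jA i c)); rewrite -gconjX (hom_conj eM); congr gconj.
rewrite -(jAe i) //.
have CX n : C i (c ^+ n) by exact: (subgrpXz (Posz n) (Csub i) Cc).
have jA1 : jA i 1 = 1.
  by apply: (@gmulI _ (jA i c)); rewrite -jAM ?gmul1r //; exact: (CX 0%N).
by elim: (p) => [|n IHn] /=; rewrite ?jA1 // jAM ?IHn.
Qed.

Definition Zgrp : Grp.
Proof.
apply: (@MkGroup int (fun x y => x + y)%R 0%R (fun x => - x)%R).
- exact: addrA.
- exact: add0r.
- exact: addr0.
- exact: addNr.
- exact: addrN.
Defined.

Definition trivial_grp : Grp.
Proof.
by apply: (@MkGroup unit (fun _ _ => tt) tt (fun _ => tt)) => // -[].
Defined.

Lemma Zgrp_pow (a : Zgrp) n : a ^+ n = ((a : int) * Posz n)%R.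
Proof.
elim: n => [|n IHn]; first by rewrite mulr0.
by rewrite gpowS IHn intS mulrDr mulr1.
Qed.

Lemma Zgrp_powz (a : Zgrp) z : gpowz a z = ((a : int) * z)%R.
Proof. by case: z => n; rewrite /gpowz Zgrp_pow // NegzE mulrN. Qed.

(* A free group as the amalgam of copies of the integers over the trivial group.
   Taking one copy for each element of [F] rather than of [S] suffices, since [F]
   only has to be a retract. *)
Theorem free_root_group (S : Type) (F : Grp) (iS : S -> F) : is_free_group iS ->
  exists (K : Grp) (e : F -> K) (rho : K -> F),
  [/\ root_group K, is_hom e, is_hom rho & forall x, rho (e x) = x].
Proof.
move=> HF.
have [||||||||||K [e [jA [rK eM jAM jAe univ]]]] := @star_amalgam trivial_grp Zgrp F
  (fun _ _ => True) (fun _ _ => True) (fun _ _ => 1) _ _ _ _ _ _ _ _ _ _ => //.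
- by move=> _ [] [].
- by move=> _ a a' _ _; exact: addrC.
- move=> _ a a' n _ _ n0; rewrite !Zgrp_pow; nia.
- move=> _ a a' _ _ a'0; apply/commensurableP.
  exists `|(a' : int)|%N, ((a : int) * sgz (a' : int))%R; split.
    by rewrite absz_gt0; apply/eqP.
  by rewrite Zgrp_pow Zgrp_powz abszEsg; ring.
- by move=> i j [].
- by move=> [].
have [|||rho [rM _ rA]] := univ F (fun=> 1) (fun x n => gpowz x n).
- by move=> x y; rewrite gmul1l.
- by move=> x a b _ _; exact: gpowzD.
- by [].
have [f [fM [fS _]]] := HF _ (fun s => jA (iS s) (1%R : int)).
exists K, f, rho; split=> // x.
have [psi [_ [_ psi_uniq]]] := HF F iS.
transitivity (psi x); last by apply/esym/(psi_uniq id).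
apply: (psi_uniq (rho \o f)) => [|s /=]; first exact: is_hom_comp.
by rewrite fS rA //; exact: gpow1.
Qed.

(** * Sequential colimits *)

Definition eventually (P : nat -> Prop) := exists N, forall n, (N <= n)%N -> P n.

Lemma eventuallyT (P : nat -> Prop) : (forall n, P n) -> eventually P.
Proof. by exists 0%N. Qed.

Lemma eventually2 (P Q R : nat -> Prop) : (forall n, P n -> Q n -> R n) ->
  eventually P -> eventually Q -> eventually R.
Proof.
move=> PQR [N HN] [M HM]; exists (maxn N M) => n; rewrite geq_max => /andP[].
by move=> /HN Pn /HM Qn; exact: PQR.
Qed.

Lemma eventually1 (P Q : nat -> Prop) : (forall n, P n -> Q n) ->
  eventually P -> eventually Q.
Proof. by move=> PQ [N HN]; exists N => n /HN /PQ. Qed.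

Lemma eventually_witness (P : nat -> Prop) : eventually P -> exists n, P n.
Proof. by case=> N HN; exists N; exact: HN. Qed.

(** The induction on [n] shifts the whole family, which avoids transports between the types [G m];
    [g0] fills the places before [n]. *)
Lemma coherent_extension (G : nat -> Type) (e : forall n, G n -> G n.+1)
    (g0 : forall n, G n) n (u : G n) :
  exists f : forall m, G m, f n = u /\ forall m, (n <= m)%N -> f m.+1 = e m (f m).
Proof.
elim: n G e g0 u => [|n IHn] G e g0 u.
  by exists (nat_rect G u e).
have [f [fn fe]] := IHn (fun m => G m.+1) (fun m => e m.+1) (fun m => g0 m.+1) u.
exists (fun m => match m with 0%N => g0 0%N | m.+1 => f m end); split=> //.
by case=> // m; exact: fe.
Qed.

Section Colimit.
Unset Implicit Arguments.
Variables (G : nat -> Grp) (e : forall n, G n -> G n.+1).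
Hypothesis eM : forall n, is_hom (e n).
Set Implicit Arguments.

Definition coherent (f : forall n, G n) := eventually (fun n => f n.+1 = e n (f n)).
Definition eveq (f h : forall n, G n) := eventually (fun n => f n = h n).

(** Elements are classes of eventually coherent sequences, so no composite maps from [G m] to [G n]
    are needed. [ev n] reads the n-th term of a chosen representative and is therefore
    multiplicative only for large [n]. *)
Lemma colimit_group : exists (H : Grp) (ev : forall n, H -> G n),
  [/\ forall x y, eventually (fun n => ev n (x * y) = ev n x * ev n y),
      forall x y, eventually (fun n => ev n x = ev n y) -> x = y,
      forall x, coherent (ev^~ x) &
      forall f, coherent f -> exists x, eveq (ev^~ x) f].
Proof.
have eveq_refl f : eveq f f by exact: eventuallyT.
have eveq_sym f h : eveq f h -> eveq h f by exact: eventually1.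
have eveq_trans f h k : eveq f h -> eveq h k -> eveq f k.
  by apply: eventually2 => n ->.
have coh_eq f h : eveq f h -> coherent f -> coherent h.
  move=> [N fh]; apply: eventually2 (ex_intro _ N (fun n H => H)) => n le_n.
  by rewrite -!fh // (leq_trans le_n).
have cohM f h : coherent f -> coherent h -> coherent (fun n => f n * h n).
  by apply: eventually2 => n -> ->; rewrite eM.
have coh1 : coherent (fun n => 1) by apply: eventuallyT => n; rewrite (hom1 (eM n)).
have cohV f : coherent f -> coherent (fun n => (f n)^-1).
  by apply: eventually1 => n ->; rewrite (homV (eM n)).
have := class_representatives eveq_refl eveq_sym eveq_trans; case=> rep [repP repE].
have rep_idem f : rep (rep f) = rep f by apply/esym/repE.
pose T := {f : forall n, G n | coherent f /\ rep f = f}.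
have mkP f : coherent f -> coherent (rep f) /\ rep (rep f) = rep f.
  by move=> cf; split=> //; exact: coh_eq cf.
pose mk f cf : T := exist _ (rep f) (mkP f cf).
have Teq (x y : T) : eveq (sval x) (sval y) -> x = y.
  by case: x y => [f [cf rf]] [h [ch rh]] /= /repE fh; apply: eq_exist; rewrite -rf fh.
pose mul (x y : T) := mk _ (cohM _ _ (proj1 (svalP x)) (proj1 (svalP y))).
pose inv (x : T) := mk _ (cohV _ (proj1 (svalP x))).
have mulE (x y : T) : eveq (sval (mul x y)) (fun n => sval x n * sval y n).
  exact/eveq_sym/repP.
have invE (x : T) : eveq (sval (inv x)) (fun n => (sval x n)^-1).
  exact/eveq_sym/repP.
have oneE : eveq (sval (mk _ coh1)) (fun n => 1) by exact/eveq_sym/repP.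
have mulA x y z : mul x (mul y z) = mul (mul x y) z.
  apply: Teq; apply: (eveq_trans _ _ _ (mulE _ _)).
  apply: (eveq_trans _ _ _ _ (eveq_sym _ _ (mulE _ _))).
  by apply: eventually2 (mulE y z) (mulE x y) => n -> ->; rewrite gmulA.
have mul1l x : mul (mk _ coh1) x = x.
  apply: Teq; apply: (eveq_trans _ _ _ (mulE _ _)).
  by apply: eventually1 oneE => n ->; rewrite gmul1l.
have mul1r x : mul x (mk _ coh1) = x.
  apply: Teq; apply: (eveq_trans _ _ _ (mulE _ _)).
  by apply: eventually1 oneE => n ->; rewrite gmul1r.
have mulVl x : mul (inv x) x = mk _ coh1.
  apply: Teq; apply: (eveq_trans _ _ _ (mulE _ _)).
  by apply: eventually2 oneE (invE x) => n -> ->; rewrite gmulVl.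
have mulVr x : mul x (inv x) = mk _ coh1.
  apply: Teq; apply: (eveq_trans _ _ _ (mulE _ _)).
  by apply: eventually2 oneE (invE x) => n -> ->; rewrite gmulVr.
exists (MkGroup mulA mul1l mul1r mulVl mulVr), (fun n x => sval x n).
split=> [x y|x y|x|f cf]; first exact: mulE.
- exact: Teq.
- exact: (proj1 (svalP x)).
- by exists (mk _ cf); exact/eveq_sym/repP.
Qed.

End Colimit.

Section EventualHom.
Unset Implicit Arguments.
Variables (H : Grp) (G : nat -> Grp) (ev : forall n, H -> G n).
Set Implicit Arguments.
Hypothesis evM : forall x y, eventually (fun n => ev n (x * y) = ev n x * ev n y).

Lemma ev1 : eventually (fun n => ev n 1 = 1).
Proof.
apply: eventually1 (evM 1 1) => n; rewrite gmul1l => e.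
by apply: (@gmulI _ (ev n 1)); rewrite -e gmul1r.
Qed.

Lemma evV x : eventually (fun n => ev n x^-1 = (ev n x)^-1).
Proof.
apply: eventually2 ev1 (evM x x^-1) => n; rewrite gmulVr => -> e.
exact/ginv_uniq/esym.
Qed.

Lemma evX x m : eventually (fun n => ev n (x ^+ m) = ev n x ^+ m).
Proof.
elim: m => [|m IHm]; first exact: ev1.
by apply: eventually2 IHm (evM x (x ^+ m)) => n /= <-.
Qed.

Lemma ev_conj t x : eventually (fun n => ev n (gconj t x) = gconj (ev n t) (ev n x)).
Proof.
apply: eventually2 (evM t (x * t^-1)) _; last first.
  apply: eventually2 (evM x t^-1) (evV t) => n; exact: conj.
by move=> n e [e1 e2]; rewrite /gconj e e1 e2.
Qed.

Lemma ev_comm x y : eventually (fun n => ev n (gcomm x y) = gcomm (ev n x) (ev n y)).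
Proof.
apply: eventually2 (evM (x^-1 * y^-1) (x * y)) _; last first.
  apply: eventually2 (evM x y) _; last first.
    apply: eventually2 (evM x^-1 y^-1) _; last first.
      apply: eventually2 (evV x) (evV y) => n; exact: conj.
    by move=> n; exact: conj.
  by move=> n; exact: conj.
by move=> n e [e1 [e2 [e3 e4]]]; rewrite /gcomm e e1 e2 e3 e4.
Qed.

(** An equation involves finitely many products, so it already holds at some finite stage. *)
Lemma ev_cl_le (hs : seq H) (gs : forall n, seq (G n)) k :
  eventually (fun n => map (ev n) hs = gs n) -> cl_le hs k ->
  exists n, cl_le (gs n) k.
Proof.
move=> evhs [ts [ps [st [sp eq]]]].
have E1 : eventually (fun n => ev n (gprod [seq gconj tg.1 tg.2 | tg <- zip ts hs]) =
    gprod [seq gconj tg.1 tg.2 | tg <- zip (map (ev n) ts) (map (ev n) hs)]).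
  elim: ts hs {st eq evhs} => [|t ts IHts] [|h hs]; do ?exact: ev1.
  apply: eventually2 (evM (gconj t h) (gprod [seq gconj tg.1 tg.2 | tg <- zip ts hs])) _;
    last first.
    apply: eventually2 (ev_conj t h) (IHts hs) => n; exact: conj.
  by move=> n e [e1 e2] /=; rewrite e e1 e2.
have E2 : eventually (fun n => ev n (gprod [seq gcomm p.1 p.2 | p <- ps]) =
    gprod [seq gcomm p.1 p.2 | p <- [seq (ev n p.1, ev n p.2) | p <- ps]]).
  elim: ps {sp eq} => [|p ps IHps]; first exact: ev1.
  apply: eventually2 (evM (gcomm p.1 p.2) (gprod [seq gcomm p.1 p.2 | p <- ps])) _;
    last first.
    apply: eventually2 (ev_comm p.1 p.2) IHps => n; exact: conj.
  by move=> n e [e1 e2] /=; rewrite e e1 e2.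
have [n [e0 [e1 e2]]] : exists n, map (ev n) hs = gs n /\ _ :=
  eventually_witness (eventually2 (fun n => @conj _ _) evhs
    (eventually2 (fun n => @conj _ _) E1 E2)).
exists n, (map (ev n) ts), [seq (ev n p.1, ev n p.2) | p <- ps].
by rewrite -e0 !size_map -e1 -e2 eq.
Qed.

End EventualHom.

(** * Groups with unique roots as Q-groups *)

Section RationalPowers.
Variable G : Grp.
Hypothesis UR : unique_roots G.
Hypothesis root_exists : forall (g : G) n, (0 < n)%N -> exists h, h ^+ n = g.
Local Open Scope ring_scope.

Lemma absz_denq_gt0 (a : rat) : (0 < `|denq a|)%N.
Proof. by rewrite absz_gt0 denq_neq0. Qed.

Lemma rational_powers : exists Q : QGrp, qgrp Q = G.
Proof.
have /choice[f fP] : forall ga : G * rat,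
    exists h, gpow h `|denq ga.2|%N = gpowz ga.1 (numq ga.2).
  by move=> [g a]; apply: root_exists; exact: absz_denq_gt0.
pose pw g a := f (g, a).
have pwP g a : gpow (pw g a) `|denq a|%N = gpowz g (numq a) by exact: (fP (g, a)).
have denE a : a * (`|denq a|%N%:Z)%:~R = (numq a)%:~R.
  by rewrite absz_denq numqE.
(* The power may be recognised from any fraction [n / d] equal to [a], reduced or not; each axiom
   then follows with a common denominator. *)
have pw_uniq g a h d n : (0 < d)%N -> a * (d%:Z)%:~R = n%:~R ->
    gpow h d = gpowz g n -> h = pw g a.
  move=> d0 an e; apply: (UR (n := (d * `|denq a|)%N)).
    by rewrite muln_gt0 d0 absz_denq_gt0.
  rewrite gpowM e -gpowzMn mulnC gpowM pwP -gpowzMn; congr gpowz.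
  apply: (@intr_inj rat); rewrite !intrM -an -denE; ring.
have pw_comm g h a b : gcommute g h -> gcommute (pw g a) (pw h b).
  move=> gh; apply: (gcommute_root UR (absz_denq_gt0 b)); rewrite pwP.
  apply/gcommutez/gcommute_sym/(gcommute_root UR (absz_denq_gt0 a)); rewrite pwP.
  exact/gcommutez/gcommute_sym.
have d0 a := absz_denq_gt0 a.
unshelve eexists (@MkQGroup G pw _ _ _ _ _ _ _) => //.
- by move=> g; apply/esym/(pw_uniq _ _ _ 1%N 0); rewrite ?mul0r ?gpow1.
- by move=> g; apply/esym/(pw_uniq _ _ _ 1%N 1); rewrite ?mul1r.
- move=> a; apply/esym/(pw_uniq _ _ _ _ _ (d0 a) (denE a)).
  by rewrite gpow_one gpowz1.
- move=> g a b; apply/esym.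
  apply: (pw_uniq _ _ _ (`|denq a| * `|denq b|)%N
    (numq a * `|denq b|%N%:Z + numq b * `|denq a|%N%:Z)).
  + by rewrite muln_gt0 !d0.
  + rewrite PoszM intrD !intrM -!denE; ring.
  + rewrite gpowMc; last exact: pw_comm.
    by rewrite gpowM pwP mulnC gpowM pwP gpowzD !gpowzMn.
- move=> g a b; apply: (pw_uniq _ _ _ (`|denq b| * `|denq a|)%N (numq a * numq b)).
  + by rewrite muln_gt0 !d0.
  + rewrite PoszM !intrM -!denE; ring.
  + by rewrite gpowM pwP -gpowzMn (mulrC (numq b)) (gpowzM (pw g a)) gpowz_nat pwP
      -gpowzM.
- move=> g h a; apply/esym/(pw_uniq _ _ _ _ _ (d0 a) (denE a)).
  by rewrite -!/(gconj _ _) -gconjX pwP gconjXz.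
- move=> g h a gh; apply/esym/(pw_uniq _ _ _ _ _ (d0 a) (denE a)).
  by rewrite gpowMc ?pwP ?gpowzMc //; exact: pw_comm.
Qed.

End RationalPowers.

(** * The tower of root extensions *)

Record stage (F : Grp) := Stage {
  stage_grp :> Grp;
  stage_in : F -> stage_grp;
  stage_set : finType;
  stage_out : stage_grp -> wreath F stage_set;
  stage_root_group : root_group stage_grp;
  stage_inM : is_hom stage_in;
  stage_outM : is_hom stage_out;
  stage_set_gt0 : (0 < #|stage_set|)%N;
  stage_in_out : forall g, stage_out (stage_in g) = wdiag stage_set g }.

Lemma next_stage (F : Grp) (s : stage F) p : prime p ->
  exists t : {t : stage F & s -> t},
    [/\ is_hom (projT2 t), forall g, projT2 t (stage_in s g) = stage_in (projT1 t) g &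
        forall g, exists u, u ^+ p = projT2 t g].
Proof.
move=> pp; have [K [e [theta [rK eM tM te rt]]]] :=
  root_extension (stage_root_group s) pp.
pose rho (x : K) := wcomp (wmap (@stage_out F s) (theta x)).
have rhoM : is_hom rho.
  move=> x y; rewrite /rho tM (wmapM (@stage_outM F s)).
  exact: (@wcompM F (stage_set s) 'I_p).
have rho_diag g : rho (e (stage_in s g)) = wdiag (stage_set s * 'I_p)%type g.
  rewrite /rho te -(wcomp_diag _ 'I_p); congr wcomp.
  by congr pair; apply: funext => i /=; rewrite stage_in_out.
have X0 : (0 < #|{: stage_set s * 'I_p}|)%N.
  by rewrite card_prod card_ord muln_gt0 stage_set_gt0 prime_gt0.
pose t := Stage rK (is_hom_comp eM (@stage_inM F s)) rhoM X0 rho_diag.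
by exists (existT (fun t : stage F => s -> t) t e).
Qed.

Theorem isometric_Q_group (S : Type) (F : Grp) (iS : S -> F) : is_free_group iS ->
  exists (Q : QGrp) (j : F -> Q), is_hom j /\
    forall gs k, cl_le (map j gs) k ->
      exists2 N, (0 < N)%N & cl_le [seq g ^+ N | g <- gs] (N * (k + 3 * size gs)).
Proof.
move=> HF; have [K [e0 [rho0 [rK e0M rho0M e0K]]]] := free_root_group HF.
have outM : is_hom (fun x => wdiag unit (rho0 x)).
  by move=> x y; rewrite rho0M wdiagM.
have outE g : wdiag unit (rho0 (e0 g)) = wdiag unit g by rewrite e0K.
have u0 : (0 < #|{: unit}|)%N by rewrite card_unit.
pose s0 := Stage rK e0M outM u0 outE.
(* This sequence takes each prime infinitely often, since the smallest prime factor of a power of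
   [q] is [q]. *)
pose p n := pdiv n.+2.
have pp n : prime (p n) by exact: pdiv_prime.
pose tower := fix tower n : stage F :=
  if n is n'.+1 then projT1 (sval (cid (next_stage (tower n') (pp n')))) else s0.
pose e n : tower n -> tower n.+1 := projT2 (sval (cid (next_stage (tower n) (pp n)))).
have eP n := svalP (cid (next_stage (tower n) (pp n))).
have eM n : is_hom (e n) by case: (eP n).
have e_in n g : e n (stage_in (tower n) g) = stage_in (tower n.+1) g.
  by have [_ H _] := eP n; exact: H.
have e_root n g : exists u, u ^+ p n = e n g.
  by have [_ _ H] := eP n; exact: H.
have [H [ev [evM ev_sep ev_coh ev_surj]]] := colimit_group eM.
have UR : unique_roots H.
  move=> x y n n0 exy; apply: ev_sep.
  apply: eventually2 (evX evM x n) (evX evM y n) => m; rewrite exy => -> eq.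
  by have [URm _] := stage_root_group (tower m); apply: URm eq.
have prime_root q (x : H) : prime q -> exists y, y ^+ q = x.
  move=> qp; have [N HN] := ev_coh x.
  (* Chosen so that [n.+2] is a power of [q] and [n] is at least [N], where [x] has become
     coherent. *)
  pose n := ((q ^ N.+2).-2)%N.
  have le_n : (N <= n)%N.
    by have := ltn_expl N.+2 (prime_gt1 qp); rewrite /n; lia.
  have pq : p n = q.
    rewrite /p /n; have := ltn_expl N.+2 (prime_gt1 qp).
    case E : (q ^ N.+2)%N => [|[|m]] // _.
    by rewrite /= -E pdiv_pfactor.
  have [u uE] := e_root n (ev n x).
  have [f [fn fe]] := coherent_extension e (fun n => 1) u.
  have fcoh : coherent e f by exists n.+1 => m /fe.
  have [y yf] := ev_surj f fcoh; exists y; apply: ev_sep.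
  apply: eventually2 (evX evM y q) _; last first.
    apply: eventually2 yf (_ : eventually (fun m => f m ^+ q = ev m x)); last first.
      exists n.+1 => m le_m; rewrite -(subnK le_m).
      elim: (m - n.+1)%N => [|d IHd]; first by rewrite add0n fn -pq uE HN.
      rewrite addSn fe ?leq_addl // -(homX (eM _)) IHd HN //; lia.
    by move=> m; exact: conj.
  by move=> m -> [-> <-].
have root n (x : H) : (0 < n)%N -> exists y, y ^+ n = x.
  have [M le_M] := ubnP n; elim: M n x le_M => // M IHM n x le_M n0.
  have [n1|n1] := leqP n 1.
    exists x; have -> : n = 1%N by lia.
    exact: gpow1.
  have /dvdnP[m mE] := pdiv_dvd n; have qp := pdiv_prime n1.
  have [y yx] := prime_root _ x qp.
  have m0 : (0 < m)%N by move: n0; rewrite mE muln_gt0 => /andP[].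
  have [|z zy] := IHM m y _ m0.
    by have := prime_gt1 qp; move: le_M; rewrite {1}mE; nia.
  by exists z; rewrite mE gpowM zy.
have [Q QH] := rational_powers UR (fun g n => @root n g).
subst H.
have /choice[j jP] : forall g : F, exists x : Q,
    eventually (fun n => ev n x = stage_in (tower n) g).
  by move=> g; apply: ev_surj; exists 0%N => n _; rewrite e_in.
exists Q, j; split=> [g h|gs k].
  apply: ev_sep; apply: eventually2 (evM (j g) (j h)) _; last first.
    apply: eventually2 (jP (gmul g h)) _; last first.
      by apply: eventually2 (jP g) (jP h) => n; exact: conj.
    by move=> n; exact: conj.
  by move=> n -> [-> [-> ->]]; rewrite stage_inM.
have evj : eventually (fun n => map (ev n) (map j gs) = map (stage_in (tower n)) gs).
  elim: gs => [|g gs IHgs]; first exact: eventuallyT.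
  by apply: eventually2 (jP g) IHgs => n /= -> ->.
move=> /(ev_cl_le evM evj)[n /(hom_cl_le (@stage_outM F (tower n)))].
rewrite -map_comp (eq_map (@stage_in_out F (tower n))) => /transfer_cl_le H.
by exists #|stage_set (tower n)|; first exact: stage_set_gt0.
Qed.

(** * Stable commutator length *)

Lemma limn_einf_sup_einfs (R : realType) (u : (\bar R)^nat) :
  limn_einf u = ereal_sup (range (einfs u)).
Proof. by rewrite limn_einf_lim; apply/cvg_lim => //; exact: cvg_einfs_sup. Qed.

Section Isometry.
Variables (G H : Grp) (f : G -> H) (R : realType) (c : nat).
Hypothesis fM : is_hom f.
Variable gs : seq G.
Hypothesis cl_bound : forall m k, cl_le (map f [seq g ^+ m | g <- gs]) k ->
  exists2 N, (0 < N)%N & cl_le [seq g ^+ (m * N)%N | g <- gs] (N * (k + c)).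

Lemma map_powers n : [seq h ^+ n | h <- map f gs] = map f [seq g ^+ n | g <- gs].
Proof. by rewrite -!map_comp; apply: eq_map => g /=; rewrite homX. Qed.

(** A homomorphism does not increase [cl]. Conversely, a bound [k] at exponent [m] in [H] gives the
    quotient (k + c)/m at exponent [m * N] in [G]. For a lower limit one such large exponent per [m]
    and [k] suffices, and c/m tends to 0. *)
Lemma scl_int_isometry : scl_int R (map f gs) = scl_int R gs.
Proof.
rewrite /scl_int; set v := (fun n => _); set u := (fun n => _).
rewrite !limn_einf_sup_einfs; apply/eqP; rewrite eq_le; apply/andP; split.
  apply/ereal_supP => _ [n _ <-]; apply: le_trans (ereal_sup_ubound _); last by exists n.
  apply/ereal_infP => _ [m /= nm <-]; apply: le_trans (_ : v m <= _)%E.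
    by apply: ereal_inf_lbound; exists m.
  rewrite /u /v; apply: lee_wpmul2r; first by rewrite lee_fin invr_ge0.
  rewrite map_powers; apply/ereal_infP => _ [k uk <-].
  by apply: ereal_inf_lbound; exists k => //; exact: hom_cl_le.
apply/ereal_supP => _ [n _ <-]; apply/lee_addgt0Pr => e e0.
(* For [m >= n'] the first term gives [m > 0] and [m * N >= n], the second c/m < e. *)
pose n' := maxn n.+1 (Num.truncn (c%:R / e)%R).+1.
have vn' : (einfs u n - e%:E <= einfs v n')%E.
  apply/ereal_infP => _ [m /= n'm <-]; rewrite /v map_powers.
  have m0 : (0 < m)%N by move: n'm; rewrite /n' geq_max => /andP[]; lia.
  have mR : (0 < m%:R :> R)%R by rewrite ltr0n.
  rewrite lee_pdivlMr //; apply/ereal_infP => _ [k /cl_bound[N N0 HN] <-].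
  rewrite -lee_pdivlMr // -EFinM EFinN leeBlDr // -EFinD.
  have mN0 : (0 < (m * N)%:R :> R)%R by rewrite ltr0n muln_gt0 m0.
  apply: le_trans (_ : u (m * N)%N <= _)%E.
    apply: ereal_inf_lbound; exists (m * N)%N => //=.
    by move: n'm; rewrite /n' geq_max => /andP[]; nia.
  rewrite /u lee_pdivrMr // -EFinM.
  apply: le_trans (_ : (N * (k + c))%:R%:E <= _)%E.
    by apply: ereal_inf_lbound; exists (N * (k + c))%N.
  rewrite lee_fin !natrM natrD.
  have NR : (0 < N%:R :> R)%R by rewrite ltr0n.
  have -> : ((k%:R / m%:R + e) * (m%:R * N%:R) = N%:R * (k%:R + e * m%:R))%R.
    by field; rewrite gt_eqF.
  rewrite ler_pM2l // lerD2l.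
  have: (c%:R / e < m%:R)%R.
    apply: lt_le_trans (truncnS_gt _) _; rewrite ler_nat.
    by move: n'm; rewrite /n' geq_max => /andP[].
  by rewrite ltr_pdivrMr // mulrC => /ltW.
have : (einfs u n - e%:E <= ereal_sup (range (einfs v)))%E.
  by apply: le_trans vn' _; apply: ereal_sup_ubound; exists n'.
by rewrite leeBlDr.
Qed.

End Isometry.

Lemma expand_int_push (G H : Grp) (f : G -> H) (c : seq (G * int)) : is_hom f ->
  expand_int [seq (f p.1, p.2) | p <- c] = map f (expand_int c).
Proof.
move=> fM; rewrite /expand_int map_flatten -!map_comp; congr flatten.
by apply: eq_map => p /=; case: ifP => _; rewrite map_nseq ?homV.
Qed.

(** The extension of [scl_int] to rational and real chains manipulates only the coefficients, which
    [f] does not change. *)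
Lemma scl_isometric_int (G H : Grp) (f : G -> H) : is_hom f ->
  (forall (R : realType) gs, scl_int R (map f gs) = scl_int R gs) -> scl_isometric f.
Proof.
move=> fM fI R c.
have fR (q : seq (G * rat)) : scl_rat R [seq (f p.1, p.2) | p <- q] = scl_rat R q.
  rewrite /scl_rat big_map -map_comp.
  set N := (\prod_(p <- q) _)%R.
  by rewrite -fI -expand_int_push // -map_comp.
have zip_push (qs : seq rat) : zip (unzip1 (push_chain f c)) qs =
    [seq (f p.1, p.2) | p <- zip (unzip1 c) qs].
  by elim: c qs => [|p c' IHc] [|q qs] //=; rewrite IHc.
rewrite /scl; congr ereal_sup; congr image; apply: funext => e.
congr ereal_inf; rewrite /push_chain size_map -/(push_chain f c).
have -> : unzip2 (push_chain f c) = unzip2 c by rewrite /unzip2 -map_comp.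
congr image; apply: funext => qs; by rewrite zip_push fR.
Qed.

Theorem theoremB (S : Type) (F : Grp) (iS : S -> F)
  (HF : is_free_group iS) (FQ : QGrp) (j : F -> FQ)
  (Hj : is_Q_completion j) :
  scl_isometric (G := F) (H := FQ) j.
Proof.
have [jM univ] := Hj; have [Q [i [iM i_bound]]] := isometric_Q_group HF.
have [psi [[psiM _] [psi_j _]]] := univ Q i iM.
apply: (scl_isometric_int jM) => R gs.
(* [psi] carries an equation in [FQ] to one in [Q] with the same number of commutators, where
   [i_bound] applies to the m-th powers of [gs]. *)
apply: (scl_int_isometry R (c := (3 * size gs)%N) jM) => m k /(hom_cl_le psiM).
rewrite -map_comp (eq_map psi_j) => /i_bound[N N0 HN]; exists N => //.
move: HN; rewrite -map_comp size_map.
by congr cl_le; apply: eq_map => g /=; rewrite gpowM.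
Qed.
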